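(* Let $f\in\mathcal C^2(\mathbb R^m\times\mathbb R^d)$ and $g\in\mathcal C^3(\mathbb R^m\times\mathbb R^d)$, and suppose the lower-level PL$^\circ$ assumption holds. Fix $\theta_0\in\Theta$ and suppose that $x_0$ is the unique minimizer of $f(\theta_0,\cdot)$ over $\mathcal S(\theta_0)$ and that $x_0$ is non-degenerate. Then there exist a neighborhood $\mathcal U$ of $\theta_0$ and a (unique) $\mathcal C^1$ selection $x^\star:\mathcal U\to\mathbb R^d$ with $x^\star(\theta_0)=x_0$ and $x^\star(\theta)\in\mathcal S(\theta)$ such that $F(\theta)=f(\theta,x^\star(\theta))$ for all $\theta\in\mathcal U$. Consequently, $\nabla F$ is locally Lipschitz (on $\mathcal U$).
   Context: Setting: $\Theta\subseteq\mathbb R^m$ is compact and convex; $f,g:\mathbb R^m\times\mathbb R^d\to\mathbb R$; $\mathcal S(\theta):=\arg\min_{x\in\mathbb R^d}g(\theta,x)$ and $F(\theta):=\min_{x\in\mathcal S(\theta)}f(\theta,x)$. Local PL: let $h\in\mathcal C^1(\mathbb R^d,\mathbb R)$ and let $\mathcal M$ be the set of all local minima of $h$. $h$ is locally PL (with constant $\mu>0$) if for any connected component $\mathcal M'\subseteq\mathcal M$ there is an open neighborhood $\mathcal N(\mathcal M')\supset\mathcal M'$ with $h(x)-\min_{x'\in\mathcal N(\mathcal M')}h(x')\le(2\mu)^{-1}\|\nabla h(x)\|^2$ for all $x\in\mathcal N(\mathcal M')$. PL$^\circ$ condition: $h$ satisfies PL$^\circ$ if (1) $h\in\mathcal C^2$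 is locally PL and $h\in\mathcal C^4$ on every neighborhood $\mathcal N(\mathcal M')$; (2) with $\mathcal N(\mathcal M):=\bigcup_{\mathcal M'}\mathcal N(\mathcal M')$, every $x\in\mathbb R^d\setminus\mathcal N(\mathcal M)$ with $\nabla h(x)=0$ satisfies $\nabla^2h(x)\prec0$; (3) $\mathcal M$ is contained in a compact set $\mathcal V$. Lower-level PL$^\circ$ assumption: there exist $\mu>0$ and a compact $\mathcal V\subset\mathbb R^d$, both independent of $\theta$, such that for every $\theta\in\Theta$ the function $g(\theta,\cdot)$ satisfies the PL$^\circ$ condition (with this $\mu$ and this $\mathcal V$). Known consequence (prior work): each $\mathcal S(\theta)$, $\theta\in\Theta$, is a connected compact $\mathcal C^2$ embedded submanifold of $\mathbb R^d$ without boundary. Non-degeneracy: let $\bar f_\theta:=f(\theta,\cdot)|_{\mathcal S(\theta)}$. A minimizer $x$ of $\bar f_\theta$ is non-degenerate if the Riemannian Hessian (induced Euclidean metric) satisfies $\langle v,\mathrm{Hess}_{\mathcal S(\theta)}\bar f_\theta(x)[v]\rangle>0$ for every nonzero $v$ in the tangent space of $\mathcal S(\theta)$ at $x$, where $\langle v,\mathrm{Hess}_{\mathcal S(\theta)}\bar f_\theta(x)[v]\rangle=\langle v,\nabla^2_{xx}f(\theta,x)v\rangle+\langle\nabla_xf(\theta,x),\mathrm{II}_x(v,v)\rangle$ and $\mathrm{II}_x$ is the (vector-valued) second fundamental form of $\mathcal S(\theta)$ at $x$. Convention: neighborhoods of $\theta_0$ are taken in $\Theta$ (relative topology); a map on such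 a set is $\mathcal C^1$ if it is the restriction of a $\mathcal C^1$ map defined on an open subset of $\mathbb R^m$, and $\nabla F$ is the gradient of such an extension of $F$, given by $\nabla F(\theta)=\nabla_\theta f(\theta,x^\star(\theta))-\nabla^2_{\theta x}g(\theta,x^\star(\theta))[\nabla^2_{xx}g(\theta,x^\star(\theta))]^\dagger\nabla_xf(\theta,x^\star(\theta))$ ($\dagger$ = Moore--Penrose pseudoinverse, $\nabla^2_{\theta x}g\in\mathbb R^{m\times d}$). *)

(* Defs.v *)
From HB Require Import structures.
From mathcomp Require Import all_boot all_order all_algebra.
From mathcomp Require Import all_classical all_reals all_analysis.
Set Implicit Arguments.
Unset Strict Implicit.
Unset Printing Implicit Defensive.
Import Order.TTheory GRing.Theory Num.Theory.
Import numFieldNormedType.Exports.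
Local Open Scope classical_set_scope.
Local Open Scope ring_scope.

(* Points of R^n are row vectors.  The library norm on 'rV[R]_n is the sup
   norm, so the Euclidean structure is given by [dot] below. *)

(* C^k on an open set A.  In finite dimension the differential is C^k as a map
   into linear maps iff x |-> 'D_v h x is C^k for every direction v.  A is meant
   to be open. *)
Fixpoint Ck (R : realType) (V W : normedModType R) (k : nat) (A : set V)
    (h : V -> W) : Prop :=
  match k with
  | 0 => forall x, A x -> {for x, continuous h}
  | k'.+1 => (forall x, A x -> differentiable h x) /\
             (forall v : V, Ck k' A (fun x => 'D_v h x))
  end.

Section Euclidean.
Context {R : realType}.

Definition dot n (u v : 'rV[R]_n) : R := (u *m v^T) 0 0.

Definition qform n (A : 'M[R]_n) (v : 'rV[R]_n) : R := (v *m A *m v^T) 0 0.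

Definition basis_vec n (i : 'I_n) : 'rV[R]_n := delta_mx 0 i.

Definition grad n (h : 'rV[R]_n -> R) (x : 'rV[R]_n) : 'rV[R]_n :=
  \row_i 'D_(basis_vec i) h x.

Definition hess n (h : 'rV[R]_n -> R) (x : 'rV[R]_n) : 'M[R]_n :=
  \matrix_(i, j) 'D_(basis_vec i) (fun y => 'D_(basis_vec j) h y) x.

Definition hess_mixed m n (g : 'rV[R]_m -> 'rV[R]_n -> R)
    (theta : 'rV[R]_m) (x : 'rV[R]_n) : 'M[R]_(m, n) :=
  \matrix_(i, j)
    'D_(basis_vec i) (fun t => 'D_(basis_vec j) (g t) x) theta.

Definition negdef n (A : 'M[R]_n) := forall v, v != 0 -> qform A v < 0.

(* The four Penrose equations characterize the pseudoinverse uniquely. *)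
Definition is_pinv m n (A : 'M[R]_(m, n)) (B : 'M[R]_(n, m)) : Prop :=
  [/\ A *m B *m A = A, B *m A *m B = B,
      (A *m B)^T = A *m B & (B *m A)^T = B *m A].

Definition pinv m n (A : 'M[R]_(m, n)) : 'M[R]_(n, m) :=
  xget 0 [set B | is_pinv A B].

End Euclidean.

Section Minima.
Context {R : realType}.

Definition argmin T (A : set T) (h : T -> R) : set T :=
  [set x | A x /\ forall y, A y -> h x <= h y].

Definition is_min T (A : set T) (h : T -> R) (v : R) : Prop :=
  exists2 x, argmin A h x & h x = v.

Definition min_value T (A : set T) (h : T -> R) : R :=
  xget 0 [set v | is_min A h v].

Definition local_minima n (h : 'rV[R]_n -> R) : set 'rV[R]_n :=
  [set x | \forall y \near x, h x <= h y].

End Minima.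

Section PolyakLojasiewicz.
Context {R : realType} {n : nat}.
Implicit Types (h : 'rV[R]_n -> R) (C : set 'rV[R]_n).

Definition components (A : set 'rV[R]_n) : set (set 'rV[R]_n) :=
  [set connected_component A x | x in A].

(* N maps each component of the set of local minima to the neighborhood on
   which the inequality holds; the minimum over it is required to be attained. *)
Definition PL_neighborhoods (mu : R) h (N : set 'rV[R]_n -> set 'rV[R]_n) :=
  forall C, components (local_minima h) C ->
  [/\ open (N C), C `<=` N C &
      exists2 v, is_min (N C) h v &
        forall x, N C x ->
          h x - v <= (2 * mu)^-1 * dot (grad h x) (grad h x)].

Definition PLcirc (mu : R) (V : set 'rV[R]_n) h : Prop :=
  exists N : set 'rV[R]_n -> set 'rV[R]_n,
  [/\ Ck 2 setT h,
      PL_neighborhoods mu h N,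
      forall C, components (local_minima h) C -> Ck 4 (N C) h,
      forall x, ~ (\bigcup_(C in components (local_minima h)) N C) x ->
        grad h x = 0 -> negdef (hess h x)
    & local_minima h `<=` V].

End PolyakLojasiewicz.

Section Submanifold.
Context {R : realType} {n : nat}.
Implicit Types (S : set 'rV[R]_n) (x v w : 'rV[R]_n).

(* Velocities at x of C^1 curves in S. *)
Definition tangent_space S x : set 'rV[R]_n :=
  [set v | exists c : R -> 'rV[R]_n,
     [/\ exists2 I : set R, open I /\ I 0 & Ck 1 I c,
         \forall t \near (0 : R), S (c t), c 0 = x & 'D_1 c 0 = v]].

Definition normal_space S x : set 'rV[R]_n :=
  [set u | forall v, tangent_space S x v -> dot u v = 0].

(* II_x(v, w) is the normal component of the Euclidean derivative D_v W, where W
   is any local C^1 field tangent to S with W x = w.  On a C^2 submanifold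
   it exists and does not depend on W. *)
Definition is_second_fundamental_form S x v w : set 'rV[R]_n :=
  [set u | exists (O : set 'rV[R]_n) (W : 'rV[R]_n -> 'rV[R]_n),
     [/\ open O /\ O x, Ck 1 O W,
         forall y, O y -> S y -> tangent_space S y (W y), W x = w
       & normal_space S x u /\ tangent_space S x ('D_v W x - u)]].

Definition second_fundamental_form S x v w : 'rV[R]_n :=
  xget 0 (is_second_fundamental_form S x v w).

Definition riemannian_hess (h : 'rV[R]_n -> R) S x v : R :=
  qform (hess h x) v + dot (grad h x) (second_fundamental_form S x v v).

Definition nondegenerate_at (h : 'rV[R]_n -> R) S x : Prop :=
  forall v, tangent_space S x v -> v != 0 -> 0 < riemannian_hess h S x v.

End Submanifold.

Section RelativeRegularity.
Context {R : realType} {m : nat}.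

Definition C1_extension (V : normedModType R) (U : set 'rV[R]_m)
    (h h' : 'rV[R]_m -> V) : Prop :=
  (exists2 O, open O /\ U `<=` O & Ck 1 O h') /\
  (forall theta, U theta -> h' theta = h theta).

Definition C1_on (V : normedModType R) (U : set 'rV[R]_m)
    (h : 'rV[R]_m -> V) : Prop :=
  exists h', C1_extension U h h'.

Definition locally_lipschitz_on (V : normedModType R) (U : set 'rV[R]_m)
    (h : 'rV[R]_m -> V) : Prop :=
  forall theta, U theta ->
    exists2 B, nbhs theta B & [lipschitz h t | t in U `&` B].

End RelativeRegularity.

Section Bilevel.
Context {R : realType} {m d : nat}.
Implicit Types (f g : 'rV[R]_m -> 'rV[R]_d -> R) (theta : 'rV[R]_m).

Definition lower_sol g theta : set 'rV[R]_d := argmin setT (g theta).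

Definition upper_value f g theta : R :=
  min_value (lower_sol g theta) (f theta).

Definition hypergradient f g theta (x : 'rV[R]_d) : 'rV[R]_m :=
  grad (fun t => f t x) theta -
  (hess_mixed g theta x *m pinv (hess (g theta) x) *m (grad (f theta) x)^T)^T.

Definition C1_selection f g (theta0 : 'rV[R]_m) (x0 : 'rV[R]_d)
    (U : set 'rV[R]_m) (xs : 'rV[R]_m -> 'rV[R]_d) : Prop :=
  [/\ C1_on U xs, xs theta0 = x0 &
      forall theta, U theta ->
        lower_sol g theta (xs theta) /\
        upper_value f g theta = f theta (xs theta)].

End Bilevel.

(* Main.v *)
(* Write G for the gradient of g in x, H for its Hessian.

   Lower level.  Let a minimize g(t0, .) and let P be the orthogonal projection
   onto the range of H(t0, a).  By the implicit function theorem the equation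
   P G(t, x) = 0 has near (t0, a) a solution manifold parametrized by t and by
   the kernel component of x.  At a point of it, G lies in the kernel of
   H(t0, a), along which G is almost constant; so a gradient step of length
   2 / mu lowers g by at least |G|^2 / mu, whereas the PL inequality allows only
   |G|^2 / (2 mu).  Hence G = 0, and for t in Theta the minimizers form a
   relatively open and closed subset of the manifold: all of it, once they meet
   it.  That they do meet it follows from the compactness of V and the
   connectedness of S(t0), by an open-closed argument along an ultrafilter
   converging to t0.

   Upper level.  By compactness the minimizers of f(t, .) over S(t) are close to
   x0, and they satisfy P G = 0 and grad f = u H H with u orthogonal to ker
   H(t0, x0).  Differentiating H W = 0 along a tangent field W turns
   non-degeneracy into invertibility of the Jacobian of this system in (x, u),
   so the implicit function theorem yields the C^1 selection x*(t) and u(t).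

   As Theta may have empty interior, f(t, x*(t)) need not have the prescribed
   gradient; the extension F'(t) = f(t, x*(t)) - <u H, G>(t, x*(t)) has it,
   because the correction vanishes on Theta while its derivative cancels the
   contribution of the derivative of x*. *)
Require Import Defs.
From HB Require Import structures.
From mathcomp Require Import all_boot all_order all_algebra.
From mathcomp Require Import all_classical all_reals all_analysis.
From mathcomp Require Import ring lra.
Set Implicit Arguments.
Unset Strict Implicit.
Unset Printing Implicit Defensive.
Import Order.TTheory GRing.Theory Num.Theory.
Import numFieldNormedType.Exports.
Local Open Scope classical_set_scope.
Local Open Scope ring_scope.

(** * Bounded linear maps and the rules of Frechet and strict differentiation *)

Section Calculus.
Context {R : realType}.
Implicit Types U V W Z : normedModType R.

(** Linearity as a predicate on plain functions: differentials can then be given by explicit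
    formulas, with no linear structure to pack for each. *)
Definition bounded_linear V W (L : V -> W) : Prop :=
  (forall a u v, L (a *: u + v) = a *: L u + L v) /\
  (exists2 C, 0 <= C & forall v, `|L v| <= C * `|v|).

Lemma bl0 V W (L : V -> W) : bounded_linear L -> L 0 = 0.
Proof.
by move=> [lL _]; have := lL (-1) 0 0; rewrite scaler0 add0r scaleN1r addNr.
Qed.

Lemma blD V W (L : V -> W) : bounded_linear L -> {morph L : u v / u + v}.
Proof. by move=> [lL _] u v; have := lL 1 u v; rewrite !scale1r. Qed.

Lemma blZ V W (L : V -> W) a : bounded_linear L -> {morph L : u / a *: u}.
Proof. by move=> lL u; have := lL.1 a u 0; rewrite (bl0 lL) !addr0. Qed.

Lemma blN V W (L : V -> W) : bounded_linear L -> {morph L : u / - u}.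
Proof. by move=> lL u; rewrite -scaleN1r (blZ _ lL) scaleN1r. Qed.

Lemma blB V W (L : V -> W) : bounded_linear L -> {morph L : u v / u - v}.
Proof. by move=> lL u v; rewrite (blD lL) (blN lL). Qed.

Lemma bl_comp U V W (L : V -> W) (M : U -> V) :
  bounded_linear L -> bounded_linear M -> bounded_linear (L \o M).
Proof.
move=> [lL [C C0 LC]] [lM [D D0 MD]]; split=> [a u v|]; first by rewrite /= lM lL.
exists (C * D); first exact: mulr_ge0.
by move=> v /=; rewrite (le_trans (LC _))// -mulrA ler_wpM2l.
Qed.

Lemma bl_pair U V W (L : U -> V) (M : U -> W) :
  bounded_linear L -> bounded_linear M -> bounded_linear (fun u => (L u, M u)).
Proof.
move=> [lL [C C0 LC]] [lM [D D0 MD]]; split=> [a u v|]; first by rewrite lM lL.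
exists (C + D); first exact: addr_ge0.
move=> v; rewrite prod_normE ge_max/= mulrDl; apply/andP; split.
  by rewrite (le_trans (LC _))// lerDl mulr_ge0.
by rewrite (le_trans (MD _))// lerDr mulr_ge0.
Qed.

Lemma bl_fst V W : bounded_linear (fst : V * W -> V).
Proof.
split=> [a u v//|]; exists 1 => // v.
by rewrite mul1r [leRHS]prod_normE le_max lexx.
Qed.

Lemma bl_snd V W : bounded_linear (snd : V * W -> W).
Proof.
split=> [a u v//|]; exists 1 => // v.
by rewrite mul1r [leRHS]prod_normE le_max lexx orbT.
Qed.

Lemma bl_id V : bounded_linear (@idfun V).
Proof. by split=> // ; exists 1 => // v; rewrite mul1r. Qed.

Lemma bl_zero V W : bounded_linear (fun _ : V => 0 : W).
Proof.
split=> [a u v|]; first by rewrite scaler0 addr0.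
by exists 0 => // v; rewrite normr0 mul0r.
Qed.

Lemma bl_add V W (L M : V -> W) :
  bounded_linear L -> bounded_linear M -> bounded_linear (fun u => L u + M u).
Proof.
move=> [lL [C C0 LC]] [lM [D D0 MD]]; split=> [a u v|].
  by rewrite lM lL scalerDr addrACA.
exists (C + D); first exact: addr_ge0.
by move=> v; rewrite (le_trans (ler_normD _ _))// mulrDl lerD.
Qed.

Lemma bl_opp V W (L : V -> W) :
  bounded_linear L -> bounded_linear (fun u => - L u).
Proof.
move=> [lL [C C0 LC]]; split=> [a u v|]; first by rewrite lL opprD scalerN.
by exists C => // v; rewrite normrN.
Qed.

Lemma near_dist V (x : V) (P : V -> Prop) :
  (\forall y \near x, P y) <->
  exists2 r, 0 < r & forall y, `|y - x| < r -> P y.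
Proof.
split=> [/nbhs_normP[r /= r0 rP]|[r r0 rP]].
  by exists r => // y yr; apply: rP; rewrite /= distrC.
by apply/nbhs_normP; exists r => //= y; rewrite /= distrC; exact: rP.
Qed.

Lemma bl_continuous V W (L : V -> W) : bounded_linear L -> continuous L.
Proof.
move=> lL x; have [_ [C C0 LC]] := lL.
apply/cvgrPdistC_le => e e0; apply/near_dist.
have C1 : 0 < C + 1 by rewrite ltr_wpDl.
exists (e / (C + 1)) => [|y]; first by rewrite divr_gt0.
rewrite ltr_pdivlMr// -(blB lL) => /ltW ye; rewrite (le_trans (LC _))//.
by rewrite (le_trans _ ye)// mulrC ler_wpM2l// lerDl.
Qed.

Lemma near_all V (x : V) (P : V -> Prop) :
  (forall y, P y) -> \forall y \near x, P y.
Proof. by move=> Py; apply: nearW. Qed.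

Lemma near_open V (A : set V) (x : V) : open A -> A x -> \forall y \near x, A y.
Proof. by move=> oA Ax; exact: open_nbhs_nbhs. Qed.

Lemma near_sub V (x : V) (P Q : V -> Prop) :
  (forall y, P y -> Q y) -> (\forall y \near x, P y) -> \forall y \near x, Q y.
Proof. by move=> PQ; exact: filterS. Qed.

Lemma continuous_dist V W (h : V -> W) (x : V) :
  {for x, continuous h} <-> forall e, 0 < e ->
    exists2 r, 0 < r & forall y, `|y - x| < r -> `|h y - h x| <= e.
Proof.
split=> [/cvgrPdistC_le hx e e0|hx]; first exact/near_dist/hx.
by apply/cvgrPdistC_le => e /hx/near_dist.
Qed.

Lemma norm_pair_lt V W (p q : V * W) r :
  (`|p - q| < r) = (`|p.1 - q.1| < r) && (`|p.2 - q.2| < r).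
Proof. by rewrite prod_normE gt_max. Qed.

(* With [s = true] the two base points vary independently (strict
   differentiability, the pointwise form of C^1); with [s = false] the second
   one is frozen at [x] (Frechet differentiability). *)
Definition has_diff (s : bool) V W (h : V -> W) (x : V) (L : V -> W) : Prop :=
  bounded_linear L /\
  forall e, 0 < e -> exists2 r, 0 < r & forall a b,
    `|a - x| < r -> `|b - x| < r -> s || (b == x) ->
    `|h a - h b - L (a - b)| <= e * `|a - b|.

Lemma has_diffW V W (h : V -> W) x L s :
  has_diff true h x L -> has_diff s h x L.
Proof.
move=> [lL hL]; split=> // e e0; have [r r0 hr] := hL e e0.
exists r => // a b ar br _; exact: hr.
Qed.

(** With tolerance 1 the increments of [h] differ by at most [|a - b|] from those of a linear map
    bounded by [C], whence the constant [1 + C]. For [s = true] this is a Lipschitz bound on a whole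
    ball. *)
Lemma has_diff_lipschitz s V W (h : V -> W) x L : has_diff s h x L ->
  exists2 C, 0 < C & exists2 r, 0 < r & forall a b,
    `|a - x| < r -> `|b - x| < r -> s || (b == x) ->
    `|h a - h b| <= C * `|a - b|.
Proof.
move=> [[_ [C C0 LC]] /(_ 1 ltr01)[r r0 hr]].
exists (1 + C); first by rewrite ltr_wpDr.
exists r => // a b ar br sb.
rewrite -[_ - h b](subrK (L (a - b))) (le_trans (ler_normD _ _))// mulrDl.
by rewrite lerD// hr.
Qed.

Lemma has_diff_near s V W (h k : V -> W) x L :
  (\forall y \near x, h y = k y) -> has_diff s h x L -> has_diff s k x L.
Proof.
move=> /near_dist[r1 r10 hk] [lL hL]; split=> // e e0.
have [r r0 hr] := hL e e0.
exists (Num.min r r1); first by rewrite lt_min r0.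
move=> a b; rewrite !lt_min => /andP[ar ar1] /andP[br br1] sb.
by rewrite -!hk// hr.
Qed.

Lemma eq_has_diff s V W (h : V -> W) x L M :
  (forall v, L v = M v) -> has_diff s h x L -> has_diff s h x M.
Proof. by move=> /funext->. Qed.

Lemma has_diff_bl s V W (L : V -> W) x : bounded_linear L -> has_diff s L x L.
Proof.
move=> lL; split=> // e e0; exists 1 => // a b _ _ _.
by rewrite (blB lL) subrr normr0 mulr_ge0 ?normr_ge0 ?(ltW e0).
Qed.

Lemma has_diff_cst s V W (c : W) (x : V) : has_diff s (fun _ : V => c) x (fun _ : V => 0 : W).
Proof.
split; first exact: bl_zero.
by move=> e e0; exists 1 => // a b _ _ _; rewrite !subrr normr0 mulr_ge0 ?normr_ge0 ?(ltW e0).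
Qed.

Lemma has_diff_pair s U V W (h : U -> V) (k : U -> W) x L M :
  has_diff s h x L -> has_diff s k x M ->
  has_diff s (fun y => (h y, k y)) x (fun v => (L v, M v)).
Proof.
move=> [lL hL] [lM kM]; split; first exact: bl_pair.
move=> e e0; have [r r0 hr] := hL e e0; have [r1 r10 kr] := kM e e0.
exists (Num.min r r1); first by rewrite lt_min r0.
move=> a b; rewrite !lt_min => /andP[ar ar1] /andP[br br1] sb.
by rewrite prod_normE ge_max/= hr// kr.
Qed.

(** The error splits into that of [h] on an increment of [k], at most [K] times longer than [a - b],
    and the image under [L] of the error of [k]; each part receives half of [e]. *)
Lemma has_diff_comp s U V W (h : V -> W) (k : U -> V) x L M :
  has_diff s k x M -> has_diff s h (k x) L -> has_diff s (h \o k) x (L \o M).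
Proof.
move=> kM hL; have [K K0 [r r0 kr]] := has_diff_lipschitz kM.
have [lM {}kM] := kM; have [lL {}hL] := hL; have [_ [C C0 LC]] := lL.
split=> [|e e0]; first exact: bl_comp.
have [r1 r10 hr1] := hL (e / 2 / K) ltac:(by rewrite !divr_gt0).
have [r2 r20 kr2] := kM (e / 2 / (C + 1)) ltac:(by rewrite !divr_gt0// ltr_wpDl).
exists (Num.min (Num.min r r2) (r1 / K)); first by rewrite !lt_min r0 r20 divr_gt0.
move=> a b; rewrite !lt_min.
move=> /andP[/andP[ar ar2] ar1] /andP[/andP[br br2] br1] sb.
have kx y : `|y - x| < r -> `|y - x| < r1 / K -> `|k y - k x| < r1.
  move=> yr yr1; rewrite (le_lt_trans (kr _ _ yr _ _)) ?subrr ?normr0 ?eqxx ?orbT//.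
  by rewrite -ltr_pdivlMl// mulrC.
have -> : (h \o k) a - (h \o k) b - (L \o M) (a - b) =
  (h (k a) - h (k b) - L (k a - k b)) + L (k a - k b - M (a - b)).
  by rewrite (blB lL _ (M _)) addrA subrK.
rewrite (le_trans (ler_normD _ _))// [e in leRHS]splitr mulrDl lerD//.
  have := hr1 _ _ (kx _ ar ar1) (kx _ br br1).
  have -> : s || (k b == k x).
    by case: s sb {kM hL kr hr1 kr2} => //= /eqP->; rewrite eqxx.
  move=> /(_ isT)/le_trans->//.
  rewrite -mulrA ler_wpM2l ?divr_ge0 ?(ltW e0)//.
  by rewrite ler_pdivrMl// kr.
rewrite (le_trans (LC _))// (le_trans (ler_wpM2l C0 (kr2 _ _ ar2 br2 sb)))//.
rewrite mulrA ler_wpM2r// mulrCA ger_pMr ?divr_gt0//.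
by rewrite ler_pdivrMr ?mul1r ?ltr_wpDl// lerDl.
Qed.

Lemma has_diffD s V W (h k : V -> W) x L M :
  has_diff s h x L -> has_diff s k x M ->
  has_diff s (fun y => h y + k y) x (fun v => L v + M v).
Proof.
move=> hL kM.
have lD : bounded_linear (fun p : W * W => p.1 + p.2).
  by apply: bl_add; [exact: bl_fst|exact: bl_snd].
exact: has_diff_comp (has_diff_pair hL kM) (has_diff_bl _ _ lD).
Qed.

Lemma has_diffN s V W (h : V -> W) x L :
  has_diff s h x L -> has_diff s (fun y => - h y) x (fun v => - L v).
Proof.
move=> hL; exact: has_diff_comp hL (has_diff_bl _ _ (bl_opp (bl_id _))).
Qed.

Lemma has_diffB s V W (h k : V -> W) x L M :
  has_diff s h x L -> has_diff s k x M ->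
  has_diff s (fun y => h y - k y) x (fun v => L v - M v).
Proof. by move=> hL kM; apply: has_diffD => //; exact: has_diffN. Qed.

Lemma has_diff_sum s V W (I : Type) (r : seq I) (h : I -> V -> W) x L :
  (forall i, has_diff s (h i) x (L i)) ->
  has_diff s (fun y => \sum_(i <- r) h i y) x (fun v => \sum_(i <- r) L i v).
Proof.
move=> hL; elim: r => [|i r ih].
  under [X in has_diff _ X]funext do rewrite big_nil.
  under [X in has_diff _ _ _ X]funext do rewrite big_nil.
  exact: has_diff_cst.
under [X in has_diff _ X]funext do rewrite big_cons.
under [X in has_diff _ _ _ X]funext do rewrite big_cons.
exact: has_diffD.
Qed.

(** By the chain rule it is enough to treat [B] itself, whose remainder is a sum of two products,
    each with one factor that is small near the base point. *)
Lemma has_diff_bilinear s U V W Z (B : V -> W -> Z) (C : R)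
    (h : U -> V) (k : U -> W) x L M : 0 <= C ->
  (forall w, bounded_linear (B^~ w)) -> (forall v, bounded_linear (B v)) ->
  (forall v w, `|B v w| <= C * (`|v| * `|w|)) ->
  has_diff s h x L -> has_diff s k x M ->
  has_diff s (fun y => B (h y) (k y)) x (fun v => B (L v) (k x) + B (h x) (M v)).
Proof.
move=> C0 Bl Br BC hL kM.
suff BD v w : has_diff s (fun p => B p.1 p.2) (v, w)
    (fun p => B p.1 w + B v p.2).
  exact: (has_diff_comp (has_diff_pair hL kM) (BD _ _)).
split=> [|e e0].
  apply: bl_add.
    exact: (bl_comp (Bl w) (bl_fst _ _)).
  exact: (bl_comp (Br v) (bl_snd _ _)).
exists (e / 2 / (C + 1)); first by rewrite !divr_gt0// ltr_wpDl.
move=> [a1 a2] [b1 b2]; rewrite !norm_pair_lt/= => /andP[a1r a2r] /andP[b1r b2r] _.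
have -> : B a1 a2 - B b1 b2 - (B (a1 - b1) w + B v (a2 - b2)) =
    B (a1 - b1) (a2 - w) + B (b1 - v) (a2 - b2).
  rewrite !(blB (Bl _)) !(blB (Br _)).
  move: (B a1 a2) (B b1 b2) (B a1 w) (B b1 w) (B v a2) (B v b2) (B b1 a2).
  move=> p q t u i j l; rewrite !opprD !opprK !addrA.
  by rewrite [RHS](ACl ((5*3)*(1*6*2*4*7*8)))/= subrr add0r.
have n1 : `|a1 - b1| <= `|(a1, a2) - (b1, b2)|.
  by rewrite [leRHS]prod_normE le_max lexx.
have n2 : `|a2 - b2| <= `|(a1, a2) - (b1, b2)|.
  by rewrite [leRHS]prod_normE le_max lexx orbT.
have Ce u : 0 <= u -> u < e / 2 / (C + 1) -> C * u <= e / 2.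
  move=> u0 /ltW ule; rewrite (le_trans (ler_wpM2l C0 ule))// mulrCA.
  rewrite ger_pMr ?divr_gt0//.
  by rewrite ler_pdivrMr ?mul1r ?ltr_wpDl// lerDl.
rewrite (le_trans (ler_normD _ _))// [e in leRHS]splitr mulrDl lerD//.
  rewrite (le_trans (BC _ _))// (mulrC `|_|) mulrA ler_pM ?mulr_ge0//.
  exact: Ce.
by rewrite (le_trans (BC _ _))// mulrA ler_pM ?mulr_ge0//; exact: Ce.
Qed.

Lemma has_diff_continuous s V W (h : V -> W) x L :
  has_diff s h x L -> {for x, continuous h}.
Proof.
move=> /has_diff_lipschitz[C C0 [r r0 hC]]; apply/cvgrPdistC_le => e e0.
apply/near_dist; exists (Num.min r (e / C)); first by rewrite lt_min r0 divr_gt0.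
move=> y; rewrite lt_min => /andP[yr yC].
rewrite (le_trans (hC _ _ yr _ _)) ?subrr ?normr0 ?eqxx ?orbT//.
by rewrite mulrC -ler_pdivlMr// ltW.
Qed.

(** Links the predicate to the library differential, so that directional derivatives can be read off
    from an explicit [L]. *)
Lemma has_diff_is_diff s V W (h : V -> W) x L :
  has_diff s h x L -> is_diff x h L.
Proof.
move=> [lL hL].
pose pL := GRing.isLinear.Build R V W _ L lL.1.
pose LL : {linear V -> W} := HB.pack L pL.
have dh : h \o shift x = cst (h x) + LL +o_0 id.
  apply/eqaddoP => e e0; have [r r0 hr] := hL e e0.
  apply/near_dist; exists r => // y; rewrite subr0 => yr.
  have := hr (y + x) x; rewrite addrK subrr normr0 eqxx orbT => /(_ yr r0 isT).
  by rewrite /= opprD addrA.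
have cL : continuous LL by exact: bl_continuous.
have E := diff_unique cL dh.
split; last exact: E.
by apply/diff_locallyP; rewrite E.
Qed.

Lemma has_diffE s V W (h : V -> W) x L v : has_diff s h x L -> 'D_v h x = L v.
Proof.
move=> /has_diff_is_diff dh; rewrite deriveE; last exact: ex_diff.
by rewrite diff_val.
Qed.

End Calculus.

(** * The mean value theorem and strict differentiability of C^1 maps *)

Section C1.
Context {R : realType}.
Implicit Types U V W Z : normedModType R.

Lemma differentiable_has_diff V W (h : V -> W) x :
  differentiable h x -> has_diff false h x ('d h x).
Proof.
move=> dh; split.
  split=> [a u v|]; first exact: linearP.
  have /(linear_bounded_continuous _).2/linear_boundedP := diff_continuous dh.
  move=> /pinfty_ex_gt0[C C0 hC]; exists C; first exact: ltW.
  exact: hC.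
move=> e e0; have /eqaddoP/(_ e e0)/near_dist[r r0 hr] := diff_locally dh.
have {}hr y : `|y| < r -> `|h (y + x) - (h x + 'd h x y)| <= e * `|y|.
  by move=> yr; apply: hr; rewrite subr0.
exists r => // a b ar _ /eqP->; have := hr _ ar.
by rewrite subrK opprD addrA.
Qed.

Lemma has_diff_differentiable s V W (h : V -> W) x L :
  has_diff s h x L -> differentiable h x.
Proof. by move=> /has_diff_is_diff dh; exact: ex_diff. Qed.

Lemma has_diff_unique s t V W (h : V -> W) x L M :
  has_diff s h x L -> has_diff t h x M -> forall v, L v = M v.
Proof. by move=> hL hM v; rewrite -(has_diffE v hL) (has_diffE v hM). Qed.

Lemma has_diff_line s V W (h : V -> W) x v (t : R) L :
  has_diff s h (x + t *: v) L ->
  has_diff s (fun u : R => h (x + u *: v)) t (fun u => u *: L v).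
Proof.
move=> hL.
have lv : bounded_linear (fun u : R => u *: v).
  split=> [a u w|]; first by rewrite scalerDl scalerA.
  by exists `|v| => // u; rewrite normrZ mulrC.
have dk : has_diff s (fun u : R => x + u *: v) t (fun u => u *: v).
  apply: eq_has_diff (has_diffD (has_diff_cst _ _ _) (has_diff_bl _ _ lv)).
  by move=> u; rewrite add0r.
apply: eq_has_diff (has_diff_comp dk hL) => u /=.
by rewrite (blZ _ hL.1).
Qed.

Lemma mvt_line V (h : V -> R) x v (T : R) : 0 < T ->
  (forall t, 0 <= t <= T -> differentiable h (x + t *: v)) ->
  exists2 t, 0 <= t <= T & h (x + T *: v) - h x = T * 'd h (x + t *: v) v.
Proof.
move=> T0 dh; pose k (t : R) := h (x + t *: v).
have kd (t : R) : 0 <= t <= T ->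
    has_diff false k t (fun u => u *: 'd h (x + t *: v) v).
  by move=> /dh/differentiable_has_diff/has_diff_line.
have D (t : R) : t \in `]0, T[ -> is_derive t 1 k ('d h (x + t *: v) v).
  rewrite in_itv/= => /andP[/ltW t0 /ltW tT].
  have kt := kd t (introT andP (conj t0 tT)).
  apply: DeriveDef; last by rewrite (has_diffE _ kt) scale1r.
  exact: diff_derivable (has_diff_differentiable kt).
have kc : {within `[0, T], continuous k}.
  apply: continuous_in_subspaceT => t; rewrite inE/= in_itv/= => tT.
  exact: has_diff_continuous (kd _ tT).
have [t tT] := MVT_segment (ltW T0) D kc.
by rewrite /k scale0r addr0 subr0 mulrC => E; exists t.
Qed.

Lemma segment_dist_lt V (p q x : V) r t :
  `|p - x| < r -> `|q - x| < r -> 0 <= t <= 1 -> `|q + t *: (p - q) - x| < r.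
Proof.
move=> pr qr /andP[t0 t1]; have -> : q + t *: (p - q) - x =
    t *: (p - x) + (1 - t) *: (q - x).
  rewrite !scalerBr !scalerBl !scale1r.
  by rewrite !opprB !addrA; rewrite [RHS](ACl ((3*1*4*6)*(2*5)))/= addNr addr0.
rewrite (le_lt_trans (ler_normD _ _))// !normrZ.
rewrite (ger0_norm t0) (@ger0_norm _ (1 - t)) ?subr_ge0//.
(* For [t = 0] strictness comes from [q] alone; otherwise the term in [p] is strict. *)
have [->|tn0] := eqVneq t 0; first by rewrite mul0r subr0 add0r mul1r.
have -> : r = t * r + (1 - t) * r by rewrite -mulrDl subrKC mul1r.
rewrite ltr_leD//; first by rewrite ltr_pM2l// lt0r tn0.
by rewrite ler_wpM2l ?subr_ge0// ltW.
Qed.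

(** The mean value theorem on the segment from [q] to [p] turns the increment into a differential at
    an intermediate point, which is close to the one at [x] on each of the finitely many directions
    [b i]. *)
Lemma C1_has_diff V (I : finType) (c : I -> V -> R) (b : I -> V)
    (h : V -> R) (x : V) :
  (forall v, v = \sum_i c i v *: b i) -> (forall i v, `|c i v| <= `|v|) ->
  (\forall y \near x, differentiable h y) ->
  (forall i, {for x, continuous ('D_(b i) h)}) ->
  has_diff true h x ('d h x).
Proof.
move=> cb c1 /near_dist[r r0 dh] Dc.
have dx : differentiable h x by apply: dh; rewrite subrr normr0.
split=> [|e e0]; first exact: (differentiable_has_diff dx).1.
(* One share of [e] per direction; the [+ 1] keeps the denominator positive when [I] is empty. *)
pose e1 := e / (#|I|%:R + 1).
have e10 : 0 < e1 by rewrite divr_gt0// ltr_wpDl.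
have : \forall y \near x, forall i, `|'D_(b i) h x - 'D_(b i) h y| <= e1.
  apply: filter_forall => i; have /cvgrPdist_le := Dc i; exact.
move=> /near_dist[r1 r10 D1].
exists (Num.min r r1); first by rewrite lt_min r0.
move=> p q pr qr _; have v0 t := segment_dist_lt pr qr (t := t).
have dl t : 0 <= t <= 1 -> differentiable h (q + t *: (p - q)).
  by move=> /v0; rewrite lt_min => /andP[/dh].
have [t t01] := mvt_line ltr01 dl.
rewrite scale1r subrKC mul1r => ->.
have := v0 t t01; rewrite lt_min => /andP[/dh dt /D1 Dt].
have E (M : {linear V -> R}) : M (p - q) = \sum_i c i (p - q) * M (b i).
  by rewrite {1}(cb (p - q)) linear_sum; apply: eq_bigr => i _; rewrite linearZ.
rewrite !E -sumrB (le_trans (ler_norm_sum _ _ _))//.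
rewrite (@le_trans _ _ (\sum_(i : I) e1 * `|p - q|))//; last first.
  rewrite sumr_const -mulrnAl ler_wpM2r// /e1 -mulr_natr mulrAC.
  by rewrite ler_pdivrMr ?ltr_wpDl// ler_pM2l// lerDl.
apply: ler_sum => i _; rewrite -mulrBr normrM mulrC ler_pM//.
by rewrite distrC -!deriveE.
Qed.

(** Strictness at [x] also controls increments based at a nearby [y]; comparing them with the
    differential at [y] bounds [M - L], each comparison costing [e / 2]. *)
Lemma has_diff_close V W (h : V -> W) x L : has_diff true h x L ->
  forall e, 0 < e -> exists2 r, 0 < r & forall y M, `|y - x| < r ->
    has_diff false h y M -> forall v, `|M v - L v| <= e * `|v|.
Proof.
move=> [lL hL] e e0; have e20 : 0 < e / 2 by rewrite divr_gt0.
have [r r0 hr] := hL _ e20; exists (r / 2); first by rewrite divr_gt0.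
move=> y M yr [lM hM] v; have [r1 r10 hr1] := hM _ e20.
have v1 : 0 < `|v| + 1 by rewrite ltr_wpDl.
(* Small enough for [y + t v] to stay in both balls; by linearity the bound for [t v] scales back to
   [v]. *)
pose t := Num.min (r / 2) r1 / (`|v| + 1).
have t0 : 0 < t by rewrite divr_gt0// lt_min divr_gt0.
have tv : `|t *: v| < Num.min (r / 2) r1.
  rewrite normrZ gtr0_norm// mulrAC ltr_pdivrMr// ltr_pM2l ?ltrDl//.
  by rewrite lt_min divr_gt0.
move: tv; rewrite lt_min => /andP[tvr tvr1].
have yr' : `|y - x| < r by rewrite (lt_le_trans yr)// ger_pMr// invf_le1// ler1n.
have tyr : `|y - x + t *: v| < r.
  by rewrite (le_lt_trans (ler_normD _ _))// [r]splitr ltrD.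
have := hr (t *: v + y) y; rewrite -addrA (addrC (t *: v)) => /(_ tyr yr' isT).
rewrite addrK => H1.
have := hr1 (t *: v + y) y; rewrite addrK subrr normr0 eqxx => /(_ tvr1 r10 isT) H2.
rewrite -(ler_pM2l t0) -{1}(gtr0_norm t0) -normrZ scalerBr -(blZ _ lL) -(blZ _ lM).
have -> : M (t *: v) - L (t *: v) = (h (t *: v + y) - h y - L (t *: v)) -
   (h (t *: v + y) - h y - M (t *: v)).
  by set D := _ - h y; rewrite opprB [RHS]addrC addrA subrK.
rewrite (le_trans (ler_normB _ _))// (le_trans (lerD H1 H2))//.
by rewrite normrZ gtr0_norm// -mulrDl -splitr mulrCA.
Qed.

(** By [has_diff_close] differentials at nearby points are close, which is the continuity of every
    directional derivative. *)
Lemma has_diff_Ck1 V W (A : set V) (h : V -> W) :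
  open A -> (forall x, A x -> exists L, has_diff true h x L) -> Ck 1 A h.
Proof.
move=> oA hA; split=> [x /hA[L /has_diff_differentiable//]|v x Ax].
have [L hL] := hA x Ax; apply/cvgrPdistC_le => e e0.
have [r r0 hr] := has_diff_close hL (divr_gt0 e0 (ltr_wpDl (normr_ge0 v) ltr01)).
near=> y; have Ay : A y by near: y; exact: open_nbhs_nbhs.
have yr : `|y - x| < r by near: y; apply/near_dist; exists r.
have [M hM] := hA _ Ay; rewrite (has_diffE v hM) (has_diffE v hL).
rewrite (le_trans (hr _ _ yr (has_diffW _ hM) v))// mulrAC.
by rewrite ler_pdivrMr ?ltr_wpDl// ler_pM2l// lerDl.
Unshelve. all: by end_near. Qed.

Lemma CkW k V W (A : set V) (h : V -> W) : Ck k.+1 A h -> Ck k A h.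
Proof.
elim: k h => [|k ih] h [dh Dh]; first by move=> x /dh/differentiable_continuous.
by split=> // v; exact: ih.
Qed.

End C1.

(** * Norm estimates for matrices and differentiation of matrix-valued maps *)

Section Matrices.
Context {R : realType}.
Implicit Types V : normedModType R.

Lemma mx_entry_le m n (A : 'M[R]_(m, n)) i j : `|A i j| <= `|A|.
Proof.
rewrite [leRHS]/Num.Def.normr/= mx_normrE.
exact: (le_bigmax _ (fun ij => `|A ij.1 ij.2|) (i, j)).
Qed.

Lemma mx_norm_le m n (A : 'M[R]_(m, n)) C : 0 <= C ->
  (forall i j, `|A i j| <= C) -> `|A| <= C.
Proof.
by move=> C0 AC; rewrite [leLHS]/Num.Def.normr/= mx_normrE; exact: bigmax_le.
Qed.

Lemma mulmx_norm_le m n p (A : 'M[R]_(m, n)) (B : 'M[R]_(n, p)) :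
  `|A *m B| <= n%:R * (`|A| * `|B|).
Proof.
apply: mx_norm_le => [|i j]; first by rewrite !mulr_ge0.
rewrite mxE (le_trans (ler_norm_sum _ _ _))//.
rewrite (@le_trans _ _ (\sum_(k < n) `|A| * `|B|))//.
  by apply: ler_sum => k _; rewrite normrM ler_pM// mx_entry_le.
by rewrite sumr_const card_ord mulr_natl.
Qed.

Lemma bl_mulmxr m n p (B : 'M[R]_(n, p)) :
  bounded_linear (fun A : 'M[R]_(m, n) => A *m B).
Proof.
split=> [a u v|]; first by rewrite mulmxDl scalemxAl.
exists (n%:R * `|B|); first by rewrite mulr_ge0.
by move=> A; rewrite (le_trans (mulmx_norm_le _ _))// -mulrA (mulrC `|B|).
Qed.

Lemma bl_mulmxl m n p (A : 'M[R]_(m, n)) :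
  bounded_linear (fun B : 'M[R]_(n, p) => A *m B).
Proof.
split=> [a u v|]; first by rewrite mulmxDr scalemxAr.
exists (n%:R * `|A|); first by rewrite mulr_ge0.
by move=> B; rewrite (le_trans (mulmx_norm_le _ _))// -mulrA.
Qed.

Lemma bl_trmx m n : bounded_linear (fun A : 'M[R]_(m, n) => A^T).
Proof.
split=> [a u v|]; first by rewrite linearP.
exists 1 => // A; rewrite mul1r; apply: mx_norm_le => // i j.
by rewrite mxE mx_entry_le.
Qed.

Lemma bl_row_mx n1 n2 : bounded_linear
  (fun p : 'rV[R]_n1 * 'rV[R]_n2 => row_mx p.1 p.2).
Proof.
split=> [a u v|]; first by rewrite scale_row_mx add_row_mx.
exists 1 => // p; rewrite mul1r; apply: mx_norm_le => // i j.
rewrite prod_normE le_max mxE; case: (fintype.split j) => k.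
  by rewrite mx_entry_le.
by rewrite mx_entry_le orbT.
Qed.

Lemma bl_lsubmx n1 n2 : bounded_linear (fun z : 'rV[R]_(n1 + n2) => lsubmx z).
Proof.
split=> [a u v|]; first by rewrite linearP.
exists 1 => // A; rewrite mul1r; apply: mx_norm_le => // i j.
by rewrite mxE mx_entry_le.
Qed.

Lemma bl_rsubmx n1 n2 : bounded_linear (fun z : 'rV[R]_(n1 + n2) => rsubmx z).
Proof.
split=> [a u v|]; first by rewrite linearP.
exists 1 => // A; rewrite mul1r; apply: mx_norm_le => // i j.
by rewrite mxE mx_entry_le.
Qed.

Lemma has_diff_mulmx s V m n p (A : V -> 'M[R]_(m, n)) (B : V -> 'M[R]_(n, p))
    x L M : has_diff s A x L -> has_diff s B x M ->
  has_diff s (fun y => A y *m B y) x (fun v => L v *m B x + A x *m M v).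
Proof.
move=> AL BM.
apply: (@has_diff_bilinear _ s _ _ _ _ (@mulmx R m n p) n%:R) => //.
- by move=> w; exact: bl_mulmxr.
- by move=> w; exact: bl_mulmxl.
- by move=> v w; exact: mulmx_norm_le.
Qed.

Lemma has_diff_mx s V m n (A : V -> 'M[R]_(m, n)) x (L : V -> 'M[R]_(m, n)) :
  (forall i j, has_diff s (fun y => A y i j) x (fun v => L v i j)) ->
  has_diff s A x L.
Proof.
move=> AL.
have lD i j : bounded_linear (fun c : R => c *: delta_mx i j : 'M[R]_(m, n)).
  split=> [a u v|]; first by rewrite scalerDl scalerA.
  by exists `|delta_mx i j : 'M[R]_(m, n)| => // c; rewrite normrZ mulrC.
have -> : A = fun y => \sum_i \sum_j A y i j *: delta_mx i j.
  by apply/funext => y; rewrite -matrix_sum_delta.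
have -> : L = fun y => \sum_i \sum_j L y i j *: delta_mx i j.
  by apply/funext => y; rewrite -matrix_sum_delta.
apply: has_diff_sum => i; apply: has_diff_sum => j.
exact: has_diff_comp (AL i j) (has_diff_bl _ _ (lD i j)).
Qed.

Definition prod_basis m d (i : 'I_m + 'I_d) : 'rV[R]_m * 'rV[R]_d :=
  match i with inl i => (basis_vec i, 0) | inr j => (0, basis_vec j) end.

Definition prod_coord m d (i : 'I_m + 'I_d) (v : 'rV[R]_m * 'rV[R]_d) : R :=
  match i with inl i => v.1 0 i | inr j => v.2 0 j end.

Lemma prod_sum_basis m d (v : 'rV[R]_m * 'rV[R]_d) :
  v = \sum_i prod_coord i v *: prod_basis i.
Proof.
rewrite big_sumType/=; case: v => [t x].
have fstD : {morph @fst 'rV[R]_m 'rV[R]_d : u v / u + v} by [].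
have sndD : {morph @snd 'rV[R]_m 'rV[R]_d : u v / u + v} by [].
congr pair.
  rewrite (big_morph fst fstD erefl) (big_morph fst fstD erefl)/=.
  rewrite [X in _ + X]big1 => [|i _]; last by rewrite scaler0.
  by rewrite addr0 -row_sum_delta.
rewrite (big_morph snd sndD erefl) (big_morph snd sndD erefl)/=.
rewrite [X in X + _]big1 => [|i _]; last by rewrite scaler0.
by rewrite add0r -row_sum_delta.
Qed.

Lemma prod_coord_le m d i (v : 'rV[R]_m * 'rV[R]_d) :
  `|prod_coord i v| <= `|v|.
Proof.
by rewrite prod_normE le_max; case: i => i /=; rewrite mx_entry_le ?orbT.
Qed.

Lemma Ck1_has_diff m d (h : 'rV[R]_m * 'rV[R]_d -> R) q :
  Ck 1 setT h -> has_diff true h q ('d h q).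
Proof.
move=> [dh Dh].
apply: (C1_has_diff (@prod_sum_basis m d) (@prod_coord_le m d)).
  by apply/near_dist; exists 1 => // y _; exact: dh.
by move=> i; exact: Dh.
Qed.

Lemma bl_mx n p (L : 'rV[R]_n -> 'rV[R]_p) : bounded_linear L ->
  exists M, forall v, L v = v *m M.
Proof.
move=> lL; pose pL := GRing.isLinear.Build R _ _ _ L lL.1.
pose LL : {linear 'rV[R]_n -> 'rV[R]_p} := HB.pack L pL.
by exists (lin1_mx LL) => v; rewrite mul_rV_lin1.
Qed.

Lemma injective_unitmx n (M : 'M[R]_n) :
  (forall v : 'rV[R]_n, v *m M = 0 -> v = 0) -> M \in unitmx.
Proof.
move=> M0; rewrite -row_free_unit -kermx_eq0; apply/eqP/row_matrixP => i.
by rewrite row0; apply: M0; rewrite -row_mul mulmx_ker row0.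
Qed.

(** If [v M = 0] then [v = v (M0 - M) M0^-1], whose norm is below [|v|] for [M] near [M0] unless
    [v = 0]. Each of the two products costs a factor [n] in the sup norm. *)
Lemma unitmx_near n (M0 : 'M[R]_n) : M0 \in unitmx ->
  \forall M \near M0, M \in unitmx.
Proof.
move=> uM0; apply/near_dist.
pose c := n%:R * `|invmx M0| * n%:R + 1.
have c0 : 0 < c by rewrite ltr_wpDl// !mulr_ge0.
exists c^-1; first by rewrite invr_gt0.
move=> M Mr; apply: injective_unitmx => v vM.
have vE : v = (v *m (M0 - M)) *m invmx M0.
  by rewrite mulmxBr vM subr0 mulmxK.
apply/eqP; apply: contraT; rewrite -normr_gt0 => v0.
have : `|v| <= c * (`|v| * `|M0 - M|).
  rewrite {1}vE (le_trans (mulmx_norm_le _ _))//.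
  rewrite (@le_trans _ _ (n%:R * ((n%:R * (`|v| * `|M0 - M|)) * `|invmx M0|)))//.
    by rewrite ler_wpM2l// ler_wpM2r// mulmx_norm_le.
  rewrite [leLHS](_ : _ = n%:R * `|invmx M0| * n%:R * (`|v| * `|M0 - M|)).
    by rewrite ler_wpM2r ?mulr_ge0// lerDl.
  by ring.
rewrite mulrCA -{1}(mulr1 `|v|) ler_pM2l// leNgt.
by rewrite distrC mulrC -ltr_pdivlMr ?div1r// Mr.
Qed.

End Matrices.

(** * The implicit function theorem with strict differentials *)

Section ImplicitFunction.
Context {R : realType}.
Implicit Types P : normedModType R.

Lemma bl_inverse n (A : 'rV[R]_n -> 'rV[R]_n) : bounded_linear A ->
  (forall z, A z = 0 -> z = 0) ->
  exists J, [/\ bounded_linear J, cancel A J & cancel J A].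
Proof.
move=> lA A0; have [M AM] := bl_mx lA.
have uM : M \in unitmx by apply: injective_unitmx => v; rewrite -AM; exact: A0.
exists (mulmxr (invmx M)); split=> [|z|z]; first exact: bl_mulmxr.
  by rewrite AM/= mulmxK.
by rewrite AM/= mulmxKV.
Qed.

(* A minimizer of |z - T z| over the compact ball is a fixed point. *)
Lemma contraction_fixpoint n (T : 'rV[R]_n -> 'rV[R]_n) z0 rho : 0 <= rho ->
  (forall z, `|z - z0| <= rho -> `|T z - z0| <= rho) ->
  (forall z w, `|z - z0| <= rho -> `|w - z0| <= rho ->
    `|T z - T w| <= 2^-1 * `|z - w|) ->
  exists2 z, `|z - z0| <= rho & T z = z.
Proof.
move=> rho0 TB Th; pose B := [set z | `|z - z0| <= rho].
have Bne : B !=set0 by exists z0; rewrite /B/= subrr normr0.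
have cB : compact B.
  apply: bounded_closed_compact.
    exists (`|z0| + rho); split; first exact: num_real.
    move=> N /ltW Nz z Bz; rewrite /= (le_trans _ Nz)// -[z](subrK z0).
    by rewrite (le_trans (ler_normD _ _))// addrC lerD.
  have -> : B = (fun z => `|z - z0|) @^-1` [set u | u <= rho] by [].
  apply: closed_comp; last exact: closed_le.
  move=> z _; apply/continuous_dist => e e0; exists e => // w wz.
  rewrite (le_trans (ler_dist_dist _ _))// opprB addrA subrK.
  exact: ltW.
have kc : {within B, continuous (fun z => `|z - T z|)}.
  apply/subspace_continuousP => z Bz; apply/cvgrPdistC_le => e e0.
  rewrite /= near_withinE; apply/(near_dist (V := 'rV[R]_n)).
  exists (e / 2); first by rewrite divr_gt0.
  move=> w wz Bw; rewrite (le_trans (ler_dist_dist _ _))//.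
  have -> : w - T w - (z - T z) = (w - z) - (T w - T z).
    by rewrite !opprB !addrA [RHS](ACl (1*4*3*2)).
  rewrite (le_trans (ler_normB _ _))// [e]splitr lerD ?(ltW wz)//.
  rewrite (le_trans (Th _ _ _ _))// (le_trans _ (ltW wz))//.
  by rewrite ler_piMl// invf_le1// ler1n.
have [c cB' cmin] := compact_EVT_min Bne cB kc.
move: cB'; rewrite inE => Bc; exists c => //; apply/eqP; apply: contraT.
rewrite eq_sym -subr_eq0 -normr_gt0 => c0.
have := cmin (T c); rewrite inE => /(_ (TB _ Bc)).
have := Th c (T c) Bc (TB _ Bc) => h1 h2.
by have := le_trans h2 h1; rewrite leNgt gtr_pMl// invf_lt1// ltr1n.
Qed.

(** With [J] inverse to the partial differential in [z], the simplified Newton map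
    [z - J (Phi (p, z))] is a contraction near [z0] for every [p] near [p0]. Strictness at the base
    point gives existence, uniqueness and a Lipschitz bound; differentiability at nearby points
    follows because the partial differential stays injective there. *)
Lemma implicit_function P n (Phi : P * 'rV[R]_n -> 'rV[R]_n) p0 z0 L0 :
  (\forall q \near (p0, z0), exists L, has_diff true Phi q L) ->
  has_diff true Phi (p0, z0) L0 -> (forall z, L0 (0, z) = 0 -> z = 0) ->
  Phi (p0, z0) = 0 ->
  exists phi : P -> 'rV[R]_n, [/\ phi p0 = z0,
    \forall p \near p0, Phi (p, phi p) = 0 /\ exists M, has_diff true phi p M &
    \forall q \near (p0, z0), Phi q = 0 -> q.2 = phi q.1].
Proof.
move=> /near_dist[r1 r10 dPhi] hL0 L0inj Phi0.
have lL0 := hL0.1.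
have bl0z : bounded_linear (fun z : 'rV[R]_n => (0, z) : P * 'rV[R]_n).
  by apply: bl_pair; [exact: bl_zero|exact: bl_id].
have blp0 : bounded_linear (fun p : P => (p, 0) : P * 'rV[R]_n).
  by apply: bl_pair; [exact: bl_id|exact: bl_zero].
have lA0 : bounded_linear (fun z => L0 (0, z)) := bl_comp lL0 bl0z.
have [J [lJ JA AJ]] := bl_inverse lA0 L0inj.
have [c c0 Jc] : exists2 c, 0 < c & forall z, `|J z| <= c * `|z|.
  have [_ [c c0 Jc]] := lJ; exists (c + 1); first by rewrite ltr_wpDl.
  by move=> z; rewrite (le_trans (Jc z))// ler_wpM2r// lerDl.
have Jc' z : `|z| <= c * `|L0 (0, z)| by rewrite -{1}(JA z).
(* Makes [c * e0 = 1 / 2], the contraction factor of the Newton map. *)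
pose e0 := (2 * c)^-1.
have e00 : 0 < e0 by rewrite invr_gt0 mulr_gt0.
have ce0 : c * e0 = 2^-1 by rewrite /e0 invfM mulrCA divff ?mulr1// gt_eqF.
have [r r0 strict] := hL0.2 _ e00.
have [r2 r20 close] := has_diff_close hL0 e00.
have [_ [C C0 L0C]] := lL0.
have splitL (L : P * 'rV[R]_n -> 'rV[R]_n) p z : bounded_linear L ->
    L (p, z) = L (p, 0) + L (0, z).
  by move=> lL; rewrite -(blD lL); congr L; congr pair; rewrite ?addr0 ?add0r.
have norm1 (p : P) : `|(p, 0 : 'rV[R]_n)| = `|p|.
  by rewrite prod_normE/= normr0; apply/max_idPl.
have norm2 (z : 'rV[R]_n) : `|(0 : P, z)| = `|z|.
  by rewrite prod_normE/= normr0; apply/max_idPr.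
have normle (p : P) (z : 'rV[R]_n) : `|(p, z)| <= `|p| + `|z|.
  by rewrite prod_normE/= ge_max lerDl lerDr !normr_ge0.
pose K := 2 * c * C + 1.
have K0 : 0 < K by rewrite ltr_wpDl// !mulr_ge0// ltW.
(* Two zeros of [Phi] are compared: with equal parameters this is uniqueness, in general it is the
   Lipschitz bound on [phi]. *)
have lip a b : `|a - (p0, z0)| < r -> `|b - (p0, z0)| < r ->
    Phi a = 0 -> Phi b = 0 -> `|a.2 - b.2| <= K * `|a.1 - b.1|.
  move=> ar br Phia Phib; have := strict _ _ ar br isT.
  rewrite Phia Phib subrr sub0r normrN.
  have -> : a - b = (a.1 - b.1, a.2 - b.2) by [].
  rewrite splitL//; move: (a.1 - b.1) (a.2 - b.2) => u w h.
  have : `|w| <= c * (C * `|u| + e0 * (`|u| + `|w|)).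
    rewrite (le_trans (Jc' w))// ler_wpM2l ?(ltW c0)//.
    rewrite -[L0 (0, w)](addKr (L0 (u, 0))) addrC.
    rewrite (le_trans (ler_normB _ _))// addrC lerD//.
      by rewrite (le_trans (L0C _))// norm1.
    by rewrite (le_trans h)// ler_wpM2l// ltW.
  have -> : K * `|u| = 2 * (c * (C * `|u|)) + `|u| by rewrite /K; ring.
  rewrite mulrDr (mulrA c e0) ce0.
  set X := c * (C * `|u|); move: X => X; move: (`|u|) (`|w|) => x y h1.
  lra.
have lip0 : exists2 D, 0 < D & forall p, `|p - p0| < r -> `|Phi (p, z0)| <= D * `|p - p0|.
  exists (C + e0); first by rewrite ltr_wpDl.
  move=> p pr; have := strict (p, z0) (p0, z0).
  have -> : (p, z0) - (p0, z0) = (p - p0, 0).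
    by congr pair; rewrite /= subrr.
  rewrite norm1 subrr normr0 Phi0 subr0 => /(_ pr r0 isT) h.
  rewrite -[Phi _](subrK (L0 (p - p0, 0))) (le_trans (ler_normD _ _))//.
  by rewrite addrC mulrDl lerD// (le_trans (L0C _))// norm1.
have [D D0 PhiD] := lip0.
pose rho := r / 2.
have rho0 : 0 < rho by rewrite divr_gt0.
have rhor : rho < r by rewrite gtr_pMr// invf_lt1// ltr1n.
(* The default [z0] is not reached for [p] within [d0] of [p0], where such a zero exists. *)
pose phi p := xget z0 [set z | `|z - z0| <= rho /\ Phi (p, z) = 0].
(* The second bound lets the Newton map move [z0] by at most [rho / 2]; with the factor [1 / 2] it
   then sends the ball of radius [rho] into itself. *)
have [d0 d00 [d0rho d0D]] : exists2 d0, 0 < d0 &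
    d0 <= rho /\ d0 <= rho / 2 / (c * D).
  exists (Num.min rho (rho / 2 / (c * D))); last by rewrite !ge_min !lexx orbT.
  by rewrite lt_min rho0 !divr_gt0// mulr_gt0.
have phiP p : `|p - p0| < d0 -> `|phi p - z0| <= rho /\ Phi (p, phi p) = 0.
  move=> pd; have pD := lt_le_trans pd d0D.
  have pr : `|p - p0| < r := lt_trans (lt_le_trans pd d0rho) rhor.
  have ball z : `|z - z0| <= rho -> `|(p, z) - (p0, z0)| < r.
    by move=> zr; rewrite norm_pair_lt/= pr (le_lt_trans zr).
  suff [z zr Phiz] : exists2 z, `|z - z0| <= rho & Phi (p, z) = 0.
    exact: (@xgetPex _ z0 [set z | `|z - z0| <= rho /\ Phi (p, z) = 0]
      (ex_intro _ z (conj zr Phiz))).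
  have Th z w : `|z - z0| <= rho -> `|w - z0| <= rho ->
      `|(z - J (Phi (p, z))) - (w - J (Phi (p, w)))| <= 2^-1 * `|z - w|.
    move=> zr wr.
    have -> : z - J (Phi (p, z)) - (w - J (Phi (p, w))) =
       - J (Phi (p, z) - Phi (p, w) - L0 (0, z - w)).
      rewrite (blB lJ) (blB lJ _ (Phi (p, w))) JA !opprB !addrA.
      by rewrite [RHS](ACl (1*4*3*2)).
    rewrite normrN (le_trans (Jc _))// -ce0 -mulrA ler_pM2l//.
    have := strict (p, z) (p, w) (ball _ zr) (ball _ wr) isT.
    have -> : (p, z) - (p, w) = (0, z - w) by congr pair; rewrite /= subrr.
    by rewrite norm2.
  have TB z : `|z - z0| <= rho -> `|z - J (Phi (p, z)) - z0| <= rho.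
    move=> zr; rewrite -[_ - z0](subrKA (z0 - J (Phi (p, z0)))).
    rewrite (le_trans (ler_normD _ _))// [rho in leRHS]splitr lerD//.
      rewrite (le_trans (Th _ _ zr _))// ?subrr ?normr0 ?(ltW rho0)//.
      by rewrite mulrC ler_pM2r// invr_gt0.
    rewrite addrAC subrr sub0r normrN (le_trans (Jc _))//.
    rewrite (le_trans (ler_wpM2l (ltW c0) (PhiD _ pr)))// mulrA mulrC.
    by rewrite -ler_pdivlMr ?mulr_gt0// ltW.
  have [z zr Tz] := contraction_fixpoint (ltW rho0) TB Th.
  exists z => //; have J0 : J (Phi (p, z)) = 0.
    by apply/eqP; rewrite -oppr_eq0; apply/eqP/(addrI z); rewrite addr0.
  by rewrite -(AJ (Phi (p, z))) J0 (bl0 lA0).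
have d0r p : `|p - p0| < d0 -> `|p - p0| < r.
  by move=> pd; exact: lt_trans (lt_le_trans pd d0rho) rhor.
have near_graph p : `|p - p0| < d0 -> `|(p, phi p) - (p0, z0)| < r.
  move=> pd; rewrite norm_pair_lt/= d0r//; have [pr _] := phiP p pd.
  exact: le_lt_trans rhor.
have phi_lip a b : `|a - p0| < d0 -> `|b - p0| < d0 ->
    `|phi a - phi b| <= K * `|a - b|.
  move=> ad bd; apply: (lip (a, phi a) (b, phi b)); [exact: near_graph|
    exact: near_graph|exact: (phiP _ ad).2|exact: (phiP _ bd).2].
have p0d : `|p0 - p0| < d0 by rewrite subrr normr0.
have phi0 : phi p0 = z0.
  apply/eqP; rewrite -subr_eq0 -normr_le0.
  have := lip (p0, phi p0) (p0, z0) (near_graph _ p0d).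
  by rewrite !subrr !normr0 mulr0 => /(_ r0 (phiP _ p0d).2 Phi0).
exists phi; split=> //; last first.
  apply/near_dist; exists (Num.min d0 r); first by rewrite lt_min d00.
  move=> [p z]; rewrite lt_min norm_pair_lt/= => /andP[/andP[pd _] pzr] Phiz.
  apply/eqP; rewrite -subr_eq0 -normr_le0.
  have := lip (p, z) (p, phi p) pzr (near_graph _ pd) Phiz (phiP _ pd).2.
  by rewrite subrr normr0 mulr0.
have [r4 r40 [r41 r42]] : exists2 r4, 0 < r4 & r4 <= r1 /\ r4 <= r2.
  by exists (Num.min r1 r2); rewrite ?lt_min ?r10// !ge_min !lexx orbT.
apply/near_dist; exists (Num.min d0 (Num.min r4 (r4 / K))).
  by rewrite !lt_min d00 r40 divr_gt0.
move=> p; rewrite !lt_min => /and3P[pd pr prK].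
split; first exact: (phiP _ pd).2.
have qr : `|(p, phi p) - (p0, z0)| < r4.
  rewrite norm_pair_lt/= pr -phi0 (le_lt_trans (phi_lip _ _ pd p0d))//.
  by rewrite mulrC -ltr_pdivlMr.
have [L hL] := dPhi _ (lt_le_trans qr r41); have qr2 := lt_le_trans qr r42.
have Lclose := close _ _ qr2 (has_diffW _ hL).
have lL := hL.1.
have lA : bounded_linear (fun z => L (0, z)) := bl_comp lL bl0z.
(* [L] is within [e0] of [L0], so a kernel vector satisfies [|z| <= c e0 |z| = |z| / 2]. *)
have Linj z : L (0, z) = 0 -> z = 0.
  move=> Lz; have := Lclose (0, z); rewrite Lz sub0r normrN norm2 => h.
  have : `|z| <= 2^-1 * `|z|.
    by rewrite (le_trans (Jc' z))// -ce0 -mulrA ler_pM2l.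
  move=> h1; apply/eqP; rewrite -normr_le0; move: (`|z|) h1 => t; lra.
have [JL [lJL JLA AJL]] := bl_inverse lA Linj.
have [_ [cL cL0 JLc]] := lJL.
(* The implicit derivative: minus the inverse of the partial differential in [z] applied to the one
   in [p]. *)
exists (fun v => - JL (L (v, 0))); split.
  exact: bl_opp (bl_comp lJL (bl_comp lL blp0)).
move=> e epos.
have [e' e'0 eE] : exists2 e', 0 < e' & e = (cL + 1) * e' * (1 + K).
  have den0 : 0 < (cL + 1) * (1 + K).
    by apply: mulr_gt0; [exact: ltr_wpDl|exact: addr_gt0].
  exists (e / ((cL + 1) * (1 + K))); first by rewrite divr_gt0.
  by rewrite mulrAC mulrC divfK// gt_eqF.
have [r3 r30 hr3] := hL.2 _ e'0.
exists (Num.min (Num.min r3 (r3 / K)) (d0 - `|p - p0|)).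
  by rewrite !lt_min r30 divr_gt0// subr_gt0.
have in_d0 a : `|a - p| < d0 - `|p - p0| -> `|a - p0| < d0.
  move=> ad; rewrite -(subrKA p) (le_lt_trans (ler_normD _ _))//.
  by rewrite -ltrBrDr.
have graph_r3 a : `|a - p| < r3 -> `|a - p| < r3 / K -> `|a - p0| < d0 ->
    `|(a, phi a) - (p, phi p)| < r3.
  move=> a1 a2 ad; rewrite norm_pair_lt/= a1 (le_lt_trans (phi_lip _ _ ad pd))//.
  by rewrite mulrC -ltr_pdivlMr.
move=> a b; rewrite !lt_min => /andP[/andP[a1 a2] /in_d0 ad].
move=> /andP[/andP[b1 b2] /in_d0 bd] _.
have := hr3 _ _ (graph_r3 _ a1 a2 ad) (graph_r3 _ b1 b2 bd) isT.
rewrite (phiP _ ad).2 (phiP _ bd).2 subrr sub0r normrN.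
have -> : (a, phi a) - (b, phi b) = (a - b, phi a - phi b) by [].
move=> h; rewrite opprK -{1}(JLA (phi a - phi b)) -(blD lJL) addrC -splitL//.
rewrite (le_trans (JLc _))// (le_trans (ler_wpM2l cL0 h))//.
rewrite (le_trans (ler_wpM2l cL0 (ler_wpM2l (ltW e'0) (normle _ _))))//.
rewrite (@le_trans _ _ (cL * (e' * ((1 + K) * `|a - b|))))//.
  rewrite !ler_wpM2l ?(ltW e'0)// mulrDl mul1r lerD2l.
  exact: phi_lip.
have K1 : 0 <= 1 + K by rewrite addr_ge0// ltW.
by rewrite eE !mulrA !ler_wpM2r ?(ltW e'0)// lerDl.
Qed.

End ImplicitFunction.

(** * Dot product, Moore-Penrose inverse and projection onto the range *)

Section LinearAlgebra.
Context {R : realType}.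

Lemma dotE n (u v : 'rV[R]_n) : dot u v = \sum_i u 0 i * v 0 i.
Proof. by rewrite /dot mxE; apply: eq_bigr => i _; rewrite mxE. Qed.

Lemma dotC n (u v : 'rV[R]_n) : dot u v = dot v u.
Proof. by rewrite !dotE; apply: eq_bigr => i _; rewrite mulrC. Qed.

Lemma dotDl n (u v w : 'rV[R]_n) : dot (u + v) w = dot u w + dot v w.
Proof. by rewrite /dot mulmxDl mxE. Qed.

Lemma dotZl n a (u v : 'rV[R]_n) : dot (a *: u) v = a * dot u v.
Proof. by rewrite /dot -scalemxAl mxE. Qed.

Lemma dotNl n (u v : 'rV[R]_n) : dot (- u) v = - dot u v.
Proof. by rewrite -scaleN1r dotZl mulN1r. Qed.

Lemma dotBl n (u v w : 'rV[R]_n) : dot (u - v) w = dot u w - dot v w.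
Proof. by rewrite dotDl dotNl. Qed.

Lemma dot0l n (v : 'rV[R]_n) : dot 0 v = 0.
Proof. by rewrite /dot mul0mx mxE. Qed.

Lemma dot_mulmx m n (u : 'rV[R]_m) (A : 'M[R]_(m, n)) v :
  dot (u *m A) v = dot u (v *m A^T).
Proof. by rewrite /dot trmx_mul trmxK mulmxA. Qed.

Lemma dot_ge0 n (u : 'rV[R]_n) : 0 <= dot u u.
Proof. by rewrite dotE sumr_ge0// => i _; rewrite -expr2 sqr_ge0. Qed.

Lemma sqr_norm_le_dot n (u : 'rV[R]_n) : `|u| ^+ 2 <= dot u u.
Proof.
rewrite -(@ger0_norm _ (dot u u)) ?dot_ge0// -[leRHS]sqr_sqrtr ?normr_ge0//.
rewrite ler_pXn2r ?nnegrE ?sqrtr_ge0// ger0_norm ?dot_ge0//.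
apply: mx_norm_le => [|i j]; first exact: sqrtr_ge0.
rewrite -sqrtr_sqr ler_sqrt ?dot_ge0// dotE (bigD1 j)//= ord1 expr2 lerDl.
by rewrite sumr_ge0// => k _; rewrite -expr2 sqr_ge0.
Qed.

Lemma dot_eq0 n (u : 'rV[R]_n) : dot u u <= 0 -> u = 0.
Proof.
move=> u0; have := le_trans (sqr_norm_le_dot u) u0.
by rewrite real_exprn_even_le0 ?num_real// normr_eq0 => /eqP.
Qed.

Lemma dot_norm_le n (u v : 'rV[R]_n) : `|dot u v| <= n%:R * (`|u| * `|v|).
Proof.
rewrite dotE (le_trans (ler_norm_sum _ _ _))//.
rewrite (@le_trans _ _ (\sum_(k < n) `|u| * `|v|))//.
  by apply: ler_sum => k _; rewrite normrM ler_pM// mx_entry_le.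
by rewrite sumr_const card_ord mulr_natl.
Qed.

Lemma gram_unitmx m n (B : 'M[R]_(m, n)) : row_free B -> B *m B^T \in unitmx.
Proof.
move=> Bf; apply: injective_unitmx => v vB.
have /dot_eq0 : dot (v *m B) (v *m B) <= 0.
  by rewrite /dot trmx_mul mulmxA -(mulmxA v) vB mul0mx mxE.
by move=> /(congr1 (mulmx^~ (pinvmx B))); rewrite -mulmxA mulmxVp// mulmx1 mul0mx.
Qed.

(** From a full-rank factorization [A = C D] one gets [D^T (D D^T)^-1 (C^T C)^-1 C^T], the two Gram
    matrices being invertible. *)
Lemma is_pinv_exists m n (A : 'M[R]_(m, n)) : exists B, is_pinv A B.
Proof.
have [r [C [D [AE Df Cf]]]] : exists r (C : 'M[R]_(m, r)) (D : 'M[R]_(r, n)),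
    [/\ A = C *m D, row_free D & row_free C^T].
  exists (\rank A), (col_base A), (row_base A); split.
  - by rewrite mulmx_base.
  - exact: row_base_free.
  - by rewrite /row_free mxrank_tr; exact: col_base_full.
have uD : D *m D^T \in unitmx by exact: gram_unitmx.
have uC : C^T *m C \in unitmx by rewrite -{2}(trmxK C); exact: gram_unitmx.
pose Di := D^T *m invmx (D *m D^T); pose Ci := invmx (C^T *m C) *m C^T.
have DDi : D *m Di = 1%:M by rewrite /Di mulmxA mulmxV.
have CiC : Ci *m C = 1%:M by rewrite /Ci -mulmxA mulVmx.
have AB : A *m (Di *m Ci) = C *m Ci.
  by rewrite AE mulmxA -(mulmxA C) DDi mulmx1.
have BA : Di *m Ci *m A = Di *m D.
  by rewrite AE mulmxA -(mulmxA Di) CiC mulmx1.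
exists (Di *m Ci); split.
- by rewrite AB AE mulmxA -(mulmxA C) CiC mulmx1.
- by rewrite BA mulmxA -(mulmxA Di) DDi mulmx1.
- by rewrite AB /Ci !trmx_mul trmxK trmx_inv trmx_mul trmxK mulmxA.
- by rewrite BA /Di !trmx_mul trmxK trmx_inv trmx_mul trmxK mulmxA.
Qed.

Lemma pinvP m n (A : 'M[R]_(m, n)) : is_pinv A (Defs.pinv A).
Proof.
have [B AB] := is_pinv_exists A.
by apply: (@xgetPex _ 0 (is_pinv A)); exists B.
Qed.

(** The orthogonal projection onto the column space of [H]; for symmetric [H] this space is the
    orthogonal complement of the kernel. *)
Definition proj_range n (H : 'M[R]_n) : 'M[R]_n := H *m Defs.pinv H.

Section SymmetricMatrix.
Variables (n : nat) (H : 'M[R]_n).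
Hypothesis symH : H^T = H.
Local Notation P := (proj_range H).

Lemma proj_range_sym : P^T = P.
Proof. by have [] := pinvP H. Qed.

Lemma proj_range_idem : P *m P = P.
Proof. by have [HBH _ _ _] := pinvP H; rewrite /proj_range mulmxA HBH. Qed.

Lemma proj_range_mull : P *m H = H.
Proof. by have [] := pinvP H. Qed.

Lemma proj_range_mulr : H *m P = H.
Proof. by apply: trmx_inj; rewrite trmx_mul proj_range_sym symH proj_range_mull. Qed.

Lemma proj_range_ker (v : 'rV[R]_n) : v *m H = 0 -> v *m P = 0.
Proof. by rewrite /proj_range mulmxA => ->; rewrite mul0mx. Qed.

Lemma mulmx_sqr_eq0 (v : 'rV[R]_n) : v *m H *m H = 0 -> v *m H = 0.
Proof.
move=> vHH; apply: dot_eq0.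
by rewrite dot_mulmx symH dotC vHH dot0l.
Qed.

Lemma ker_split (v : 'rV[R]_n) : v *m H = 0 -> v *m (1%:M - P) = 0 -> v = 0.
Proof.
by move=> /proj_range_ker vP; rewrite mulmxBr vP mulmx1 subr0.
Qed.

(** The summands lie in complementary subspaces. This lets a single equation with values in R^n
    encode one condition on the range and one on the kernel. *)
Lemma proj_sum_eq0 (a b : 'rV[R]_n) : a *m P = a ->
  a + b *m (1%:M - P) = 0 -> a = 0 /\ b *m (1%:M - P) = 0.
Proof.
move=> aP ab; suff a0 : a = 0 by rewrite a0 add0r in ab.
move: (congr1 (mulmx^~ P) ab); rewrite mulmxDl aP -mulmxA mulmxBl mul1mx.
by rewrite proj_range_idem subrr mulmx0 addr0 mul0mx.
Qed.

(** The component [f (1 - P)] lies in the kernel, to which [f] is orthogonal, so it vanishes and [f]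
    is in the range of [H], which is also the range of [H H]. The doubled form yields a multiplier
    [u H] that is itself in the range. *)
Lemma perp_ker_range (f : 'rV[R]_n) : (forall k, k *m H = 0 -> dot f k = 0) ->
  exists u, f = u *m H *m H.
Proof.
move=> fk; have [HBH BHB HBs _] := pinvP H.
have PE : P = (Defs.pinv H)^T *m H by rewrite -proj_range_sym /proj_range trmx_mul symH.
have k0 : f *m (1%:M - P) = 0.
  apply: dot_eq0; have kH : f *m (1%:M - P) *m H = 0.
    by rewrite -mulmxA mulmxBl mul1mx proj_range_mull subrr mulmx0.
  rewrite {1}mulmxBr mulmx1 dotBl fk// sub0r dot_mulmx proj_range_sym.
  by rewrite proj_range_ker// dotC dot0l oppr0.
exists (f *m (Defs.pinv H)^T *m (Defs.pinv H)^T).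
have -> : f *m (Defs.pinv H)^T *m (Defs.pinv H)^T *m H = f *m (Defs.pinv H)^T *m P.
  by rewrite -[LHS]mulmxA PE.
rewrite -[RHS]mulmxA proj_range_mull -mulmxA -PE.
by move/eqP: k0; rewrite mulmxBr mulmx1 subr_eq0 => /eqP.
Qed.

(** Removes the pseudoinverse from the hypergradient once the gradient of the upper objective is
    written [u H H]. *)
Lemma pinv_mul_range (u : 'rV[R]_n) :
  Defs.pinv H *m (u *m H *m H)^T = (u *m H)^T.
Proof.
have [HBH _ _ BHs] := pinvP H.
rewrite !trmx_mul symH !mulmxA -BHs trmx_mul symH; congr (_ *m _).
transitivity ((H *m Defs.pinv H *m H)^T); last by rewrite HBH.
by rewrite !trmx_mul symH mulmxA.
Qed.

End SymmetricMatrix.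

End LinearAlgebra.

(** * Symmetry of second derivatives *)

Section SecondDerivatives.
Context {R : realType}.

(** The second difference [Delta s] is symmetric in [a] and [b]; the mean value theorem along [a]
    and along [b] shows it to be [s^2 La b] and [s^2 Lb a] up to [o(s^2)]. *)
Lemma derive_swap (V : normedModType R) (h : V -> R) x a b La Lb :
  (forall y, differentiable h y) ->
  has_diff true ('D_a h) x La -> has_diff true ('D_b h) x Lb -> Lb a = La b.
Proof.
move=> dh hLa hLb.
pose Delta (s : R) := h (x + s *: a + s *: b) - h (x + s *: a) -
                      (h (x + s *: b) - h x).
(* The second difference, estimated by the mean value theorem along [u]. *)
have key u v L (D : R -> R) : has_diff true ('D_u h) x L ->
    (forall s, D s = h (x + s *: u + s *: v) - h (x + s *: u) -
                     (h (x + s *: v) - h x)) ->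
    forall e, 0 < e -> exists2 r, 0 < r & forall s, 0 < s -> s < r ->
      `|D s - s * s * L v| <= s * s * e.
  move=> [lL hL] DE e e0.
  have v1 : 0 < `|v| + 1 by rewrite ltr_wpDl.
  have uv1 : 0 < `|u| + `|v| + 1 by rewrite ltr_wpDl// addr_ge0.
  have [r r0 hr] := hL _ (divr_gt0 e0 v1).
  exists (r / (`|u| + `|v| + 1)); first by rewrite divr_gt0.
  move=> s s0 sr; pose k y := h (y + s *: v) - h y.
  have hs y : has_diff false (fun y => h (y + s *: v)) y ('d h (y + s *: v)).
    have sh : has_diff false (fun y => y + s *: v) y (fun w => w).
      apply: eq_has_diff (has_diffD (has_diff_bl _ _ (bl_id _)) (has_diff_cst _ _ _)).
      by move=> w; rewrite addr0.
    exact: (has_diff_comp sh (differentiable_has_diff (dh _))).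
  have kd y := has_diffB (hs y) (differentiable_has_diff (dh y)).
  have dk t : 0 <= t <= s -> differentiable k (x + t *: u).
    by move=> _; exact: has_diff_differentiable (kd _).
  have [t /andP[t0 ts] kt] := mvt_line s0 dk.
  have -> : D s = k (x + s *: u) - k x by rewrite DE.
  rewrite kt -(deriveE u (dk t (introT andP (conj t0 ts)))).
  rewrite (has_diffE u (kd _)) -!deriveE//.
  have ns w : `|w| <= `|u| + `|v| -> `|s *: w| < r.
    move=> wle; rewrite normrZ gtr0_norm//.
    rewrite (@le_lt_trans _ _ (s * (`|u| + `|v| + 1)))//.
      by rewrite ler_pM2l// (le_trans wle)// lerDl.
    by rewrite -ltr_pdivlMr.
  have ntu w : `|t *: u + s *: w| <= s * (`|u| + `|w|).
    rewrite (le_trans (ler_normD _ _))// !normrZ (ger0_norm t0) (gtr0_norm s0).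
    by rewrite mulrDr lerD// ler_wpM2r.
  have sr' : s * (`|u| + `|v|) < r.
    rewrite (@le_lt_trans _ _ (s * (`|u| + `|v| + 1)))//.
      by rewrite ler_pM2l// lerDl.
    by rewrite -ltr_pdivlMr.
  have := hr (x + t *: u + s *: v) (x + t *: u).
  have -> : x + t *: u + s *: v - x = t *: u + s *: v.
    by rewrite -(addrA x) [LHS]addrC addKr.
  have -> : x + t *: u - x = t *: u + s *: 0.
    by rewrite scaler0 addr0 [LHS]addrC addKr.
  rewrite (le_lt_trans (ntu v) sr').
  have -> : `|t *: u + s *: 0| < r.
    rewrite (le_lt_trans (ntu 0))// (le_lt_trans _ sr')// ler_wpM2l ?(ltW s0)//.
    by rewrite normr0 addr0 lerDl.
  move=> /(_ isT isT isT).
  rewrite (addrC (x + t *: u)) addrK (blZ _ lL) normrZ gtr0_norm// => h1.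
  rewrite -mulrA -mulrBr normrM gtr0_norm// -mulrA ler_pM2l//.
  rewrite (le_trans h1)//.
  rewrite mulrCA ler_pM2l// mulrAC ler_pdivrMr// ler_pM2l// lerDl//.
have D1 := key a b La Delta hLa (fun=> erefl).
have D2 : forall e, 0 < e -> exists2 r, 0 < r & forall s, 0 < s -> s < r ->
      `|Delta s - s * s * Lb a| <= s * s * e.
  apply: (key b a) => // s; rewrite /Delta !opprB !addrA (addrAC x).
  by rewrite [RHS](ACl (1*4*3*2)).
apply/eqP; rewrite -subr_eq0 -normr_le0; apply/ler_addgt0Pl => e e0.
rewrite addr0.
have e20 : 0 < e / 2 by rewrite divr_gt0.
have [r1 r10 h1] := D1 _ e20; have [r2 r20 h2] := D2 _ e20.
pose s := Num.min r1 r2 / 2.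
have s0 : 0 < s by rewrite divr_gt0// lt_min r10.
have : s < Num.min r1 r2 by rewrite gtr_pMr ?lt_min ?r10// invf_lt1// ltr1n.
rewrite lt_min => /andP[/(h1 _ s0) {}h1 /(h2 _ s0) {}h2].
have ss0 : 0 < s * s by rewrite mulr_gt0.
suff : `|s * s * (Lb a - La b)| <= s * s * e.
  by rewrite normrM (gtr0_norm ss0) ler_pM2l.
rewrite mulrBr; have -> : s * s * Lb a - s * s * La b =
    Delta s - s * s * La b - (Delta s - s * s * Lb a) by ring.
rewrite (le_trans (ler_normB _ _))// (le_trans (lerD h1 h2))//.
by rewrite -mulrDr -splitr.
Qed.

End SecondDerivatives.

(** * Partial gradients and Hessians as derivatives on the product space *)

Section PartialDerivatives.
Context {R : realType} {m d : nat}.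
Variable g : 'rV[R]_m -> 'rV[R]_d -> R.
Let gg (p : 'rV[R]_m * 'rV[R]_d) := g p.1 p.2.
Local Notation b1 i := (@prod_basis R m d (inl i)).
Local Notation b2 i := (@prod_basis R m d (inr i)).

(** Both sides are limits of the same difference quotient. *)
Lemma derive_snd (h : 'rV[R]_m * 'rV[R]_d -> R) t x i :
  'D_(basis_vec i) (fun y => h (t, y)) x = 'D_(b2 i) h (t, x).
Proof.
apply: (congr1 (fun k : R -> R => lim (k @ 0^'))); apply/funext => s /=.
congr (_ *: (h _ - _)); congr pair => /=.
by rewrite scaler0 add0r.
Qed.

Lemma derive_fst (h : 'rV[R]_m * 'rV[R]_d -> R) t x i :
  'D_(basis_vec i) (fun s => h (s, x)) t = 'D_(b1 i) h (t, x).
Proof.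
apply: (congr1 (fun k : R -> R => lim (k @ 0^'))); apply/funext => s /=.
congr (_ *: (h _ - _)); congr pair => /=.
by rewrite scaler0 add0r.
Qed.

Lemma grad_sndE t x : grad (g t) x = \row_j 'D_(b2 j) gg (t, x).
Proof. by apply/rowP => j; rewrite !mxE; exact: (derive_snd gg). Qed.

Lemma grad_fstE t x : grad (g^~ x) t = \row_j 'D_(b1 j) gg (t, x).
Proof. by apply/rowP => j; rewrite !mxE; exact: (derive_fst gg). Qed.

Lemma hess_sndE t x :
  hess (g t) x = \matrix_(i, j) 'D_(b2 i) ('D_(b2 j) gg) (t, x).
Proof.
apply/matrixP => i j; rewrite [LHS]mxE [RHS]mxE.
apply: (etrans _ (derive_snd ('D_(b2 j) gg) t x i)).
apply: (congr1 (fun k : 'rV[R]_d -> R => 'D_(basis_vec i) k x)).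
by apply/funext => y; exact: (derive_snd gg).
Qed.

Lemma hess_mixedE t x :
  hess_mixed g t x = \matrix_(i, j) 'D_(b1 i) ('D_(b2 j) gg) (t, x).
Proof.
apply/matrixP => i j; rewrite [LHS]mxE [RHS]mxE.
apply: (etrans _ (derive_fst ('D_(b2 j) gg) t x i)).
apply: (congr1 (fun k : 'rV[R]_m -> R => 'D_(basis_vec i) k t)).
by apply/funext => y; exact: (derive_snd gg).
Qed.

Lemma Ck1_has_diff_sum (h : 'rV[R]_m * 'rV[R]_d -> R) q : Ck 1 setT h ->
  has_diff true h q (fun v =>
    \sum_i v.1 0 i * 'D_(b1 i) h q + \sum_j v.2 0 j * 'D_(b2 j) h q).
Proof.
move=> Ch; have hq := Ck1_has_diff q Ch; apply: eq_has_diff hq => v.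
rewrite {1}(prod_sum_basis v) linear_sum big_sumType/=.
have dq : differentiable h q by case: Ch => + _; exact.
by congr (_ + _); apply: eq_bigr => i _; rewrite linearZ/= -deriveE.
Qed.

Lemma has_diff_uncurry t x : Ck 1 setT gg ->
  has_diff true gg (t, x)
    (fun v => dot v.1 (grad (g^~ x) t) + dot v.2 (grad (g t) x)).
Proof.
move=> /(Ck1_has_diff_sum (t, x)); apply: eq_has_diff => v.
rewrite !dotE; congr (_ + _); apply: eq_bigr => i _.
  by rewrite grad_fstE !mxE.
by rewrite grad_sndE !mxE.
Qed.

Lemma has_diff_grad_snd t x : Ck 2 setT gg ->
  has_diff true (fun p => grad (g p.1) p.2) (t, x)
    (fun v => v.1 *m hess_mixed g t x + v.2 *m hess (g t) x).
Proof.
move=> [_ Cg]; apply: has_diff_mx => i j; rewrite ord1.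
have := Ck1_has_diff_sum (t, x) (Cg (b2 j)).
have -> : (fun p => grad (g p.1) p.2 0 j) = 'D_(b2 j) gg.
  by apply/funext => -[s y]; rewrite grad_sndE mxE.
apply: eq_has_diff => v; rewrite !mxE; congr (_ + _); apply: eq_bigr => k _.
  by rewrite hess_mixedE !mxE.
by rewrite hess_sndE !mxE.
Qed.

Lemma has_diff_grad_fst q : Ck 2 setT gg ->
  exists L, has_diff true (fun p => grad (g^~ p.2) p.1) q L.
Proof.
move=> [_ Cg].
exists (fun v => \row_j 'd ('D_(b1 j) gg) q v).
apply: has_diff_mx => i j; rewrite ord1.
have := Ck1_has_diff q (Cg (b1 j)).
have -> : (fun p => grad (g^~ p.2) p.1 0 j) = 'D_(b1 j) gg.
  by apply/funext => -[s y]; rewrite grad_fstE mxE.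
by apply: eq_has_diff => v; rewrite mxE.
Qed.

Lemma has_diff_hess q : Ck 3 setT gg ->
  exists L, has_diff true (fun p => hess (g p.1) p.2) q L.
Proof.
move=> [_ Cg].
exists (fun v => \matrix_(i, j) 'd ('D_(b2 i) ('D_(b2 j) gg)) q v).
apply: has_diff_mx => i j.
have := Ck1_has_diff q ((Cg (b2 j)).2 (b2 i)).
have -> : (fun p => hess (g p.1) p.2 i j) = 'D_(b2 i) ('D_(b2 j) gg).
  by apply/funext => -[s y]; rewrite hess_sndE mxE.
by apply: eq_has_diff => v; rewrite mxE.
Qed.

Lemma has_diff_hess_mixed q : Ck 3 setT gg ->
  exists L, has_diff true (fun p => hess_mixed g p.1 p.2) q L.
Proof.
move=> [_ Cg].
exists (fun v => \matrix_(i, j) 'd ('D_(b1 i) ('D_(b2 j) gg)) q v).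
apply: has_diff_mx => i j.
have := Ck1_has_diff q ((Cg (b2 j)).2 (b1 i)).
have -> : (fun p => hess_mixed g p.1 p.2 i j) = 'D_(b1 i) ('D_(b2 j) gg).
  by apply/funext => -[s y]; rewrite hess_mixedE mxE.
by apply: eq_has_diff => v; rewrite mxE.
Qed.

Lemma hess_sym t x : Ck 2 setT gg -> (hess (g t) x)^T = hess (g t) x.
Proof.
move=> [dg Cg]; apply/matrixP => i j; rewrite mxE !hess_sndE !mxE.
have hi := Ck1_has_diff (t, x) (Cg (b2 i)).
have hj := Ck1_has_diff (t, x) (Cg (b2 j)).
have dg' y : differentiable gg y by exact: dg.
by rewrite (has_diffE _ hi) (has_diffE _ hj); exact: (derive_swap dg' hj hi).
Qed.

End PartialDerivatives.

(** * First-order conditions, open-closed arguments and the PL inequality *)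

Section LowerLevel.
Context {R : realType}.

(** If [L v < 0], a short step along [v] lowers [h], the error being kept below the linear term;
    [- v] gives the other sign. *)
Lemma has_diff_min s (V : normedModType R) (h : V -> R) x L :
  has_diff s h x L -> (\forall y \near x, h x <= h y) -> forall v, L v = 0.
Proof.
move=> hL /near_dist[r0 r00 hx]; have lL := hL.1.
suff Lge v : 0 <= L v.
  move=> v; apply/eqP; rewrite eq_le Lge andbT.
  by have := Lge (- v); rewrite (blN lL) oppr_ge0.
rewrite leNgt; apply/negP => Lv.
have v1 : 0 < `|v| + 1 by rewrite ltr_wpDl.
have e0 : 0 < - L v / (`|v| + 1) by rewrite divr_gt0// oppr_gt0.
have [r rpos hr] := hL.2 _ e0.
have r2 : 0 < Num.min r r0 by rewrite lt_min rpos.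
pose t := Num.min r r0 / (`|v| + 1).
have t0 : 0 < t by rewrite divr_gt0.
have : `|t *: v| < Num.min r r0.
  by rewrite normrZ gtr0_norm// mulrAC ltr_pdivrMr// ltr_pM2l// ltrDl.
rewrite lt_min => /andP[tr tr0].
have := hx (x + t *: v); rewrite (addrC x) addrK => /(_ tr0) hle.
have := hr (t *: v + x) x; rewrite addrK subrr normr0 eqxx orbT => /(_ tr rpos isT).
rewrite (blZ _ lL) normrZ gtr0_norm// => /ler_normlW.
rewrite lerBlDr mulrCA -mulrDr => h1.
have neg : t * (- L v / (`|v| + 1) * `|v| + L v) < 0.
  rewrite pmulr_rlt0// -ltrBrDr sub0r mulrAC ltr_pdivrMr//.
  by rewrite ltr_pM2l ?oppr_gt0// ltrDl.
by have := le_lt_trans h1 neg; rewrite subr_lt0 ltNge hle.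
Qed.

(** The open-closed argument as an induction principle: the last two premises make [Q] relatively
    open and relatively closed in [A]. *)
Lemma connected_ind (T : topologicalType) (A : set T) (Q : T -> Prop) :
  connected A -> (exists2 x, A x & Q x) ->
  (forall x, A x -> Q x -> \forall y \near x, A y -> Q y) ->
  (forall x, A x -> (forall U, nbhs x U -> exists y, [/\ U y, A y & Q y]) -> Q x) ->
  forall x, A x -> Q x.
Proof.
move=> cA [x0 Ax0 Qx0] Qo Qc x Ax; pose B := A `&` [set y | Q y].
suff BA : B = A by move: Ax; rewrite -{1}BA => -[].
apply: cA; first by exists x0.
  exists (interior [set y | A y -> Q y]); first exact: open_interior.
  apply/seteqP; split=> [y [Ay Qy]|y [Ay /interior_subset Qy]].
    by split=> //; exact: Qo.
  by split=> //; exact: Qy.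
exists (closure B); first exact: closed_closure.
apply/seteqP; split=> [y By|y [Ay cBy]].
  by split; [case: By|exact: subset_closure].
split=> //; apply: Qc => // U /cBy[z [[Az Qz] Uz]].
by exists z.
Qed.

(** If [Bad] met every neighborhood of [x], its trace on the neighborhood filter would be proper and
    extend to an ultrafilter containing [Bad]. *)
Lemma near_ultra (T : topologicalType) (x : T) (Bad : set T) :
  (forall U : set_system T, UltraFilter U -> nbhs x `<=` U -> U Bad -> False) ->
  \forall y \near x, ~ Bad y.
Proof.
move=> noU; apply: contrapT => nx.
have pF : ProperFilter (within Bad (nbhs x)).
  split; last exact: within_filter.
  by rewrite /within/= => Fx; apply: nx; apply: filterS Fx.
have [U [uU FU]] := ultraFilterLemma pF.
apply: (noU U uU) => [A xA|]; apply: FU; rewrite /within/=.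
  by apply: filterS xA.
exact: nearW.
Qed.

Variables (m d : nat) (g : 'rV[R]_m -> 'rV[R]_d -> R).
Let gg (p : 'rV[R]_m * 'rV[R]_d) := g p.1 p.2.
Let S t := lower_sol g t.
Let G (p : 'rV[R]_m * 'rV[R]_d) := grad (g p.1) p.2.

Lemma has_diff_snd s t x : Ck 1 setT gg ->
  has_diff s (g t) x (fun v => dot v (grad (g t) x)).
Proof.
move=> Cg; have h1 : has_diff s (fun y : 'rV[R]_d => (t, y)) x (fun v => (0, v)).
  by apply: has_diff_pair; [exact: has_diff_cst|exact: has_diff_bl (bl_id _)].
apply: eq_has_diff (has_diff_comp h1 (has_diffW _ (has_diff_uncurry t x Cg))).
by move=> v; rewrite /= dot0l add0r.
Qed.

Lemma lower_sol_crit t x : Ck 1 setT gg -> S t x -> grad (g t) x = 0.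
Proof.
move=> Cg [_ Sx]; apply: dot_eq0.
rewrite (has_diff_min (has_diff_snd true t x Cg)) ?lexx//.
by apply: near_all => y; exact: Sx.
Qed.

(** As [x1] is a global minimizer lying in its PL neighborhood, the minimum over that neighborhood
    is [g t x1]. *)
Lemma PL_near mu V t x1 : PLcirc mu V (g t) -> S t x1 ->
  \forall x \near x1, g t x - g t x1 <=
    (2 * mu)^-1 * dot (grad (g t) x) (grad (g t) x).
Proof.
move=> [N [_ PL _ _ _]] Sx1; have [_ minx1] := Sx1.
have lx1 : local_minima (g t) x1 by apply: near_all => y; exact: minx1.
have Cx1 : components (local_minima (g t))
    (connected_component (local_minima (g t)) x1) by exists x1.
have [oN CN [v [y [Ny miny] <-] PLv]] := PL _ Cx1.
have Nx1 : N (connected_component (local_minima (g t)) x1) x1.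
  by apply: CN; exact: connected_component_refl.
have E : g t y = g t x1 by apply/eqP; rewrite eq_le miny//= minx1.
by apply: near_sub (near_open oN Nx1) => x /PLv; rewrite E.
Qed.

Lemma lower_sol_sub mu V t : PLcirc mu V (g t) -> S t `<=` V.
Proof.
move=> [N [_ _ _ _ MV]] x [_ Sx]; apply: MV.
by apply: near_all => y; exact: Sx.
Qed.

(* A gradient step of length [2 / mu] along [u = G p] decreases [g] by at least
   [dot u u / mu], because the gradient barely changes along a direction of
   [ker (hess)]; the PL inequality leaves room for half of that only. *)
Lemma PL_constant mu t0 a : 0 < mu -> Ck 2 setT gg -> G (t0, a) = 0 ->
  \forall p \near (t0, a), forall x1, S p.1 x1 ->
    G p *m proj_range (hess (g t0) a) = 0 ->
    gg p - g p.1 x1 <= (2 * mu)^-1 * dot (G p) (G p) -> S p.1 p.2.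
Proof.
move=> mu0 Cg G0; have hG := has_diff_grad_snd t0 a Cg.
have d1 : 0 < d%:R + 1 :> R by rewrite ltr_wpDl.
(* Over a step of length [2 / mu], and with the factor [d] lost in bounding a dot product, this
   tolerance changes [dot u (G p)] by at most half of [dot u u]. *)
have e0 : 0 < mu / (4 * (d%:R + 1)) by rewrite divr_gt0// mulr_gt0.
have [r r0 hr] := hG.2 _ e0.
have tau0 : 0 < 2 / mu by rewrite divr_gt0.
have /continuous_dist/(_ (r / 2 / (2 / mu))) := has_diff_continuous hG.
case; first by rewrite !divr_gt0.
move=> r1 r10 hr1; apply/near_dist; exists (Num.min r1 (r / 2)).
  by rewrite lt_min r10 divr_gt0.
move=> [t x]; rewrite lt_min => /andP[/hr1]; rewrite -/(G (t, x)) -/(G (t0, a)) G0 subr0.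
rewrite ler_pdivlMr// mulrC => ur; rewrite norm_pair_lt/= => /andP[tr xr] x1 [_ Sx1] uP PL.
set u := G (t, x) in ur uP PL *.
have uH : u *m hess (g t0) a = 0.
  by rewrite -(proj_range_mull (hess (g t0) a)) mulmxA uP mul0mx.
have Gs s : 0 <= s <= 2 / mu ->
    `|G (t, x + s *: - u) - u| <= mu / (4 * (d%:R + 1)) * (s * `|u|).
  move=> /andP[s0 s1]; have := hr (t, x + s *: - u) (t, x).
  have -> : (t, x + s *: - u) - (t, x) = (0, s *: - u).
    by congr pair => /=; rewrite ?subrr// addrC addKr.
  rewrite mul0mx add0r -scalemxAl mulNmx uH oppr0 scaler0 subr0.
  have -> : `|(0 : 'rV[R]_m, s *: - u)| = s * `|u|.
    by rewrite prod_normE/= normr0 max_r// normrZ normrN ger0_norm.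
  apply=> //; rewrite norm_pair_lt/= (lt_trans tr) ?gtr_pMr ?invf_lt1 ?ltr1n//=.
    rewrite addrAC (le_lt_trans (ler_normD _ _))// [r]splitr ltr_leD//.
    rewrite normrZ normrN ger0_norm// (le_trans _ ur)//.
    by rewrite ler_wpM2r.
  by rewrite (lt_trans xr)// gtr_pMr// invf_lt1// ltr1n.
have Cg1 : Ck 1 setT gg := CkW Cg.
have [s s01] := mvt_line tau0 (fun s (_ : 0 <= s <= 2 / mu) =>
  has_diff_differentiable (has_diff_snd true t (x + s *: - u) Cg1)).
rewrite -deriveE; last exact: has_diff_differentiable (has_diff_snd true t _ Cg1).
rewrite (has_diffE _ (has_diff_snd true t _ Cg1)) => E.
have dotu : dot u u / 2 <= dot u (G (t, x + s *: - u)).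
  suff Bd : d%:R * (`|G (t, x + s *: - u) - u| * `|u|) <= dot u u / 2.
    have := le_trans (dot_norm_le _ _) Bd; rewrite ler_norml => /andP[h _].
    rewrite -[G _](subrK u) dotC dotDl.
    by move: h; move: (dot (_ - _) u) (dot u u) => y z; lra.
  have := sqr_norm_le_dot u; have : 0 <= `|u| by [].
  set N := `|u| => N0 Nu.
  rewrite (@le_trans _ _ (d%:R * (mu / (4 * (d%:R + 1)) * (2 / mu * N) * N)))//.
    rewrite ler_wpM2l// ler_wpM2r// (le_trans (Gs s s01))//.
    by rewrite ler_pM2l// ler_wpM2r//; case/andP: s01.
  have -> : d%:R * (mu / (4 * (d%:R + 1)) * (2 / mu * N) * N) =
     d%:R / (d%:R + 1) * (N ^+ 2 / 2).
    by field; rewrite !gt_eqF.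
  rewrite (le_trans (ler_piMl _ _))//; last first.
  - by rewrite ler_pM2r.
  - by rewrite ler_pdivrMr// mul1r lerDl.
  - by rewrite divr_ge0// sqr_ge0.
have uu0 : dot u u <= 0.
  have lo : g t x1 <= g t (x + 2 / mu *: - u) := Sx1 _ I.
  have key : dot u u / mu <= g t x - g t x1.
    rewrite (@le_trans _ _ (g t x - g t (x + 2 / mu *: - u)))//; last first.
      by rewrite lerD2l lerN2.
    rewrite -opprB E dotNl mulrN opprK.
    rewrite (le_trans _ (ler_wpM2l (ltW tau0) dotu))//.
    by have -> : 2 / mu * (dot u u / 2) = dot u u / mu by field; rewrite gt_eqF.
  have := le_trans key PL.
  have -> : (2 * mu)^-1 * dot u u = dot u u / 2 / mu by field; rewrite gt_eqF.
  by rewrite ler_pM2r ?invr_gt0//; move: (dot u u) => z; lra.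
have u0 := dot_eq0 uu0.
(* With a zero gradient the PL inequality itself says that the value is minimal. *)
split=> // y _ /=; rewrite (le_trans _ (Sx1 y I))//.
by rewrite -subr_le0 (le_trans PL)// u0 dot0l mulr0.
Qed.

End LowerLevel.

Lemma nbhs_dist (R : realType) (V : normedModType R) (x : V) r :
  0 < r -> nbhs x [set y | `|y - x| < r].
Proof. by move=> r0; apply/near_dist; exists r. Qed.

(** Used to pass inequalities to a limit: two errors of a third of the gap cannot reverse the
    order. *)
Lemma third_gap (R : realFieldType) (a b x y : R) : x < y ->
  a - x <= (y - x) / 3 -> - ((y - x) / 3) <= b - y -> b <= a -> False.
Proof. by move=> *; lra. Qed.

(** * Local parametrization of the projected critical equation *)

Section Charts.
Context {R : realType}.
Variables (m d : nat) (g : 'rV[R]_m -> 'rV[R]_d -> R).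
Let gg (p : 'rV[R]_m * 'rV[R]_d) := g p.1 p.2.
Let S t := lower_sol g t.
Let G (p : 'rV[R]_m * 'rV[R]_d) := grad (g p.1) p.2.

(** The implicit function theorem is applied to [G P + (x - y) (1 - P) = 0] with parameter [(t, y)];
    its differential in [x] at the base point is [H0 P + (1 - P)], which is injective. *)
Lemma chart_exists t0 a : Ck 2 setT gg -> G (t0, a) = 0 ->
  let P := proj_range (hess (g t0) a) in
  exists X : 'rV[R]_m * 'rV[R]_d -> 'rV[R]_d, [/\ X (t0, a) = a,
    \forall p \near (t0, a),
      [/\ G (p.1, X p) *m P = 0, (X p - p.2) *m (1%:M - P) = 0 &
          exists M, has_diff true X p M] &
    \forall q \near ((t0, a), a),
      G (q.1.1, q.2) *m P + (q.2 - q.1.2) *m (1%:M - P) = 0 -> q.2 = X q.1].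
Proof.
move=> Cg G0 P; set H0 := hess (g t0) a in P *.
have symH : H0^T = H0 := hess_sym t0 a Cg.
pose Phi (q : ('rV[R]_m * 'rV[R]_d) * 'rV[R]_d) :=
  G (q.1.1, q.2) *m P + (q.2 - q.1.2) *m (1%:M - P).
have dPhi q : has_diff true Phi q (fun v =>
    (v.1.1 *m hess_mixed g q.1.1 q.2 + v.2 *m hess (g q.1.1) q.2) *m P +
    (v.2 - v.1.2) *m (1%:M - P)).
  have b11 := bl_comp (bl_fst 'rV[R]_m 'rV[R]_d)
    (bl_fst ('rV[R]_m * 'rV[R]_d)%type 'rV[R]_d).
  have b12 := bl_comp (bl_snd 'rV[R]_m 'rV[R]_d)
    (bl_fst ('rV[R]_m * 'rV[R]_d)%type 'rV[R]_d).
  have b2 := bl_snd ('rV[R]_m * 'rV[R]_d)%type 'rV[R]_d.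
  apply: has_diffD.
    have h1 := has_diff_bl true q (bl_pair b11 b2).
    have h2 := has_diff_comp h1 (has_diff_grad_snd q.1.1 q.2 Cg).
    by have := has_diff_comp h2 (has_diff_bl _ _ (bl_mulmxr _ P)); exact.
  have h1 := has_diffB (has_diff_bl true q b2) (has_diff_bl true q b12).
  by have := has_diff_comp h1 (has_diff_bl _ _ (bl_mulmxr _ (1%:M - P))); exact.
have PP : P *m P = P := proj_range_idem H0.
have inj (z : 'rV[R]_d) : (0 *m hess_mixed g t0 a + z *m H0) *m P + (z - 0) *m (1%:M - P) = 0 ->
    z = 0.
  rewrite mul0mx add0r subr0 => zPQ.
  have [|zHP zQ] := proj_sum_eq0 (H := H0) _ zPQ; first by rewrite -mulmxA PP.
  apply: ker_split zQ.
  by move: zHP; rewrite -mulmxA (proj_range_mulr symH).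
have Phi0 : Phi ((t0, a), a) = 0 by rewrite /Phi/= G0 mul0mx subrr mul0mx addr0.
have := @implicit_function R _ d Phi (t0, a) a _ _ (dPhi _) inj Phi0.
case; first by apply: near_all => q; eexists; exact: dPhi.
move=> X [X0 Xnear Xuniq]; exists X; split=> //.
apply: near_sub Xnear => -[t y]/= [XPhi XM].
have [] := proj_sum_eq0 (H := H0) _ XPhi; first by rewrite -mulmxA PP.
by move=> E1 E2; split.
Qed.

End Charts.

(* Near [(t0, a)] the points [X (t, y)] solve the part of [grad (g t) x = 0]
   lying in the range of the Hessian at [(t0, a)], [y] prescribing the component
   of [x] along its kernel.  The last clause says that, for [t] in [Theta], this
   solution set lies in the set of minimizers as soon as it meets it. *)
Definition solution_chart (R : realType) m d (g : 'rV[R]_m -> 'rV[R]_d -> R)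
    (Theta : set 'rV[R]_m) t0 a (X : 'rV[R]_m * 'rV[R]_d -> 'rV[R]_d) r : Prop :=
  let P := proj_range (hess (g t0) a) in 0 < r /\
  [/\ X (t0, a) = a,
    forall p, `|p - (t0, a)| < r ->
      [/\ grad (g p.1) (X p) *m P = 0, (X p - p.2) *m (1%:M - P) = 0 &
          exists M, has_diff true X p M],
    forall p, `|p - (t0, a)| < r -> grad (g p.1) p.2 = 0 -> X p = p.2 &
    forall t x1, `|t - t0| < r -> Theta t -> lower_sol g t x1 -> `|x1 - a| < r ->
      forall y, `|y - a| < r -> lower_sol g t (X (t, y))].

(** * Semicontinuity of the sets of minimizers, lower and upper level *)

Section Semicontinuity.
Context {R : realType}.
Variables (m d : nat) (g : 'rV[R]_m -> 'rV[R]_d -> R).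
Let gg (p : 'rV[R]_m * 'rV[R]_d) := g p.1 p.2.
Let S t := lower_sol g t.
Let G (p : 'rV[R]_m * 'rV[R]_d) := grad (g p.1) p.2.
Variables (mu : R) (V : set 'rV[R]_d) (Theta : set 'rV[R]_m).
Hypotheses (mu0 : 0 < mu) (Cg : Ck 2 setT gg) (cV : compact V).
Hypothesis PL : forall t, Theta t -> PLcirc mu V (g t).

Let Cg1 : Ck 1 setT gg := CkW Cg.

(** The last clause is an open-closed argument along the segment from [x1] to [y]. Near a parameter
    whose chart point is a minimizer, [PL_near] supplies the inequality that [PL_constant] asks for;
    closedness is continuity of [g]. *)
Lemma lower_sol_chart t0 a : Theta t0 -> S t0 a ->
  exists X r, solution_chart g Theta t0 a X r.
Proof.
move=> Tt0 Sa; set P := proj_range (hess (g t0) a).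
have G0 : G (t0, a) = 0 by exact: lower_sol_crit.
have [X [X0 /near_dist[r1 r10 X1] /near_dist[r3 r30 X3]]] := chart_exists Cg G0.
have /near_dist[r2 r20 cst] := PL_constant mu0 Cg G0.
have ta0 : `|(t0, a) - (t0, a)| < r1 by rewrite subrr normr0.
have [_ _ [M0 dX0]] := X1 _ ta0.
have /continuous_dist/(_ (r2 / 2) (divr_gt0 r20 (ltr0Sn _ 1)))[r4 r40 X4] :=
  has_diff_continuous dX0.
have [r [r0 rr1 rr2 rr3 rr4]] : exists r, [/\ 0 < r, r <= r1, r <= r2, r <= r3 & r <= r4].
  exists (Num.min (Num.min r1 r2) (Num.min r3 r4)); split.
  - by rewrite !lt_min r10 r20 r30.
  - by rewrite !ge_min lexx.
  - by rewrite !ge_min lexx !orbT.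
  - by rewrite !ge_min lexx !orbT.
  - by rewrite !ge_min lexx !orbT.
exists X, r; split=> //.
have X1' p : `|p - (t0, a)| < r -> [/\ G (p.1, X p) *m P = 0,
    (X p - p.2) *m (1%:M - P) = 0 & exists M, has_diff true X p M].
  by move=> pr; apply: X1; exact: lt_le_trans pr rr1.
have X3' p : `|p - (t0, a)| < r -> G p = 0 -> X p = p.2.
  case: p => t y pr Gp; have pr3 := lt_le_trans pr rr3.
  (* A critical point solves the chart equation with itself as parameter, so local uniqueness makes
     it a fixed point. *)
  symmetry; apply: (X3 ((t, y), y)) => /=.
    rewrite norm_pair_lt/= pr3/=.
    by move: pr3; rewrite norm_pair_lt => /andP[].
  by move: Gp; rewrite /G/= => ->; rewrite mul0mx subrr mul0mx addr0.
split=> // t x1 tr Tt Sx1 x1r y yr.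
have inb z : `|z - a| < r -> `|(t, z) - (t0, a)| < r.
  by move=> zr; rewrite norm_pair_lt/= tr zr.
pose k (s : R) := X (t, x1 + s *: (y - x1)).
have kd (s : R) : 0 <= s <= 1 -> exists M, has_diff true k s M.
  move=> s01; have [_ _ [M dM]] := X1' _ (inb _ (segment_dist_lt yr x1r s01)).
  have h1 : has_diff true (fun z : 'rV[R]_d => X (t, z)) (x1 + s *: (y - x1))
      (fun v => M (0, v)).
    apply: has_diff_comp dM.
    by apply: has_diff_pair; [exact: has_diff_cst|exact: has_diff_bl (bl_id _)].
  by eexists; exact: has_diff_line h1.
suff : forall s : R, s \in `[0, 1] -> S t (k s).
  by move=> /(_ 1); rewrite in_itv/= lexx ler01 /k scale1r subrKC; exact.
move=> s0 s0I; 
have ind := connected_ind (Q := fun s : R => S t (k s)) (@segment_connected R 0 1).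
apply: (ind _ _ _ s0 s0I).
- exists 0; first by rewrite /= in_itv/= lexx ler01.
  rewrite /k scale0r addr0 X3'//; first exact: inb.
  exact: lower_sol_crit.
- move=> s; rewrite /= in_itv/= => s01 Ss.
  have [M dM] := kd s s01.
  have PLs := PL_near (PL Tt) Ss.
  have := has_diff_continuous dM PLs.
  apply: (@near_sub _ R) => s' PLs'; rewrite in_itv/= => s'01.
  have yr' := inb _ (segment_dist_lt yr x1r s'01).
  apply: (cst (t, k s') _ (k s)) => //=; last by case: (X1' _ yr').
  rewrite norm_pair_lt/= (lt_le_trans tr rr2)/=.
  have := X4 _ (lt_le_trans yr' rr4); rewrite X0 => /le_lt_trans->//.
  by rewrite gtr_pMr// invf_lt1// ltr1n.
- move=> s; rewrite /= in_itv/= => s01 cl; have [M dM] := kd s s01.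
  split=> // z _; rewrite leNgt; apply/negP => lt.
  have c1 := has_diff_continuous (has_diff_comp dM (has_diff_snd true t (k s) Cg1)).
  have [s' [/= lt' _ [_ /(_ z I)]]] := cl _ (c1 _ (open_nbhs_nbhs (conj (@open_gt _ (g t z)) lt))).
  by rewrite leNgt lt'.
Qed.

(** The minimizers stay in the compact [V], so they cluster along [U]; for an ultrafilter a cluster
    point is a limit, and joint continuity of [g] carries minimality over to it. *)
Lemma ultra_sol t0 (U : set_system 'rV[R]_m) (s : 'rV[R]_m -> 'rV[R]_d) :
  UltraFilter U -> nbhs t0 `<=` U -> U [set t | Theta t /\ S t (s t)] ->
  exists2 p, S t0 p & forall e, 0 < e -> U [set t | `|s t - p| < e].
Proof.
move=> uU Ut0 US.
have VU : (s @ U) V.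
  suff : U (s @^-1` V) by [].
  by apply: filterS US => t [Tt St]; exact: (lower_sol_sub (PL Tt) St).
have [p [Vp clp]] := cV (fmap_proper_filter s ultra_proper) VU.
have Up e : 0 < e -> U [set t | `|s t - p| < e].
  move=> e0; have [//|UC] := in_ultra_setVsetC [set t | `|s t - p| < e] uU.
  have pe : nbhs p [set x | `|x - p| < e] by exact: nbhs_dist.
  have UC' : (s @ U) (~` [set x | `|x - p| < e]) by exact: UC.
  by have [x [nx xe]] := clp _ _ UC' pe.
exists p => //; split=> // y _; rewrite leNgt; apply/negP => lt.
pose e := (g t0 p - g t0 y) / 3.
have e0 : 0 < e by rewrite divr_gt0// subr_gt0.
have cont q := has_diff_continuous (has_diff_uncurry q.1 q.2 Cg1).
have /continuous_dist/(_ _ e0)[r1 r10 h1] := cont (t0, p).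
have /continuous_dist/(_ _ e0)[r2 r20 h2] := cont (t0, y).
have r0 : 0 < Num.min r1 r2 by rewrite lt_min r10.
have Ur : U [set t | `|t - t0| < Num.min r1 r2].
  exact: Ut0 (nbhs_dist _ r0).
have [t [[/= tr sr] [_ [_ /(_ y I)]]]] :=
  filter_ex (filterI (filterI Ur (Up _ r10)) US).
move: tr; rewrite lt_min => /andP[tr1 tr2].
have := h1 (t, s t); rewrite norm_pair_lt/= tr1 sr => /(_ isT); rewrite ler_norml => /andP[+ _].
have := h2 (t, y); rewrite norm_pair_lt/= tr2 subrr normr0 r20 => /(_ isT).
rewrite ler_norml => /andP[_].
exact: (third_gap lt).
Qed.

Hypothesis S_neq0 : forall t, Theta t -> S t !=set0.

(** By contradiction along an ultrafilter. The points of [S t0] that are limits of points of [S t]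
    satisfy [E]; they exist by [ultra_sol], form a relatively open set by the charts and a closed
    one by the triangle inequality, so connectedness reaches [a]. *)
Lemma lower_sol_lsc t0 a e : Theta t0 -> connected (S t0) -> S t0 a -> 0 < e ->
  \forall t \near t0, Theta t -> exists2 x, S t x & `|x - a| < e.
Proof.
move=> Tt0 cS Sa e0.
suff : \forall t \near t0, ~ (Theta t /\ ~ exists2 x, S t x & `|x - a| < e).
  apply: near_sub => t nt Tt; apply: contrapT => nx; exact: nt.
apply: near_ultra => U uU Ut0 UBad.
pose s t := xget 0 (S t).
have Ss t : Theta t -> S t (s t) by move=> /S_neq0 Sn; exact: xgetPex.
have US : U [set t | Theta t /\ S t (s t)].
  by apply: filterS UBad => t [Tt _]; split=> //; exact: Ss.
have [p Sp Up] := ultra_sol uU Ut0 US.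
pose E x := forall e, 0 < e -> U [set t | exists2 y, S t y & `|y - x| < e].
have /(_ e e0) Ue : E a.
  apply: (connected_ind cS _ _ _ Sa).
  - exists p => // e1 e10; apply: filterS (filterI US (Up _ e10)) => t [[_ St] se].
    by exists (s t).
  - move=> x Sx Ex; have [X [r [r0 [X0 XP Xfix fill]]]] := lower_sol_chart Tt0 Sx.
    apply/near_dist; exists r => // b br Sb e1 e10.
    have tbr : `|(t0, b) - (t0, x)| < r.
      by rewrite norm_pair_lt/= subrr normr0 r0.
    have [_ _ [M dM]] := XP _ tbr.
    have Xb : X (t0, b) = b by apply: Xfix => //; exact: lower_sol_crit.
    have e120 : 0 < e1 / 2 by rewrite divr_gt0.
    have /continuous_dist/(_ _ e120)[r1 r10 Xc] := has_diff_continuous dM.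
    have r20 : 0 < Num.min r r1 by rewrite lt_min r0.
    have Ur : U [set t | `|t - t0| < Num.min r r1].
      exact: Ut0 (nbhs_dist _ r20).
    apply: filterS (filterI (filterI Ur US) (Ex _ r0)).
    move=> t [[/= + [Tt _]] [y Sy yr]]; rewrite lt_min => /andP[tr tr1].
    (* Since [S t] meets the chart at [y], the chart point with parameter [b] is a minimizer too,
       and it tends to [X (t0, b) = b]. *)
    exists (X (t, b)); first exact: (fill _ y).
    have := Xc (t, b); rewrite norm_pair_lt/= tr1 subrr normr0 r10 => /(_ isT).
    by rewrite Xb => /le_lt_trans->//; rewrite gtr_pMr// invf_lt1// ltr1n.
  - move=> x Sx cl e1 e10; have e120 : 0 < e1 / 2 by rewrite divr_gt0.
    have xe : nbhs x [set y | `|y - x| < e1 / 2] by exact: nbhs_dist.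
    have [y [/= yx Sy /(_ _ e120)]] := cl _ xe.
    apply: filterS => t [z Sz zy]; exists z => //.
    by rewrite -(subrKA y) (le_lt_trans (ler_normD _ _))// [e1]splitr ltrD.
by have [t [[_ nt] /nt]] := filter_ex (filterI UBad Ue).
Qed.

Lemma lower_sol_closed t : closed (S t).
Proof.
move=> x clx; split=> // z _; rewrite leNgt; apply/negP => lt.
have c1 := has_diff_continuous (has_diff_snd true t x Cg1).
have [y [[_ /(_ z I)]]] := clx _ (c1 _ (open_nbhs_nbhs (conj (@open_gt _ (g t z)) lt))).
by rewrite /= leNgt => /negbTE->.
Qed.

Variable f : 'rV[R]_m -> 'rV[R]_d -> R.
Let ff (p : 'rV[R]_m * 'rV[R]_d) := f p.1 p.2.
Hypothesis Cf : Ck 1 setT ff.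

Lemma upper_min_exists t : Theta t -> exists x, argmin (S t) (f t) x.
Proof.
move=> Tt; have cS : compact (S t).
  by apply: subclosed_compact cV (lower_sol_sub (PL Tt)); exact: lower_sol_closed.
have fc : {within S t, continuous (f t)}.
  apply: continuous_subspaceT => x.
  exact: has_diff_continuous (has_diff_snd true t x Cf).
have [x] := compact_EVT_min (S_neq0 Tt) cS fc; rewrite inE => Sx fx.
by exists x; split=> // y Sy; apply: fx; rewrite inE.
Qed.

(** Minimizers staying away from [x0] would have a limit [p] in [S t0]. By [lower_sol_lsc] they
    compete with points of [S t] close to [x0], so [p] minimizes [f t0] over [S t0] and equals
    [x0]. *)
Lemma upper_min_near t0 x0 e : Theta t0 -> connected (S t0) ->
  argmin (S t0) (f t0) = [set x0] -> 0 < e ->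
  \forall t \near t0, Theta t ->
    forall x, argmin (S t) (f t) x -> `|x - x0| < e.
Proof.
move=> Tt0 cS min0 e0.
have [Sx0 fx0] : argmin (S t0) (f t0) x0 by rewrite min0.
suff : \forall t \near t0, ~ (Theta t /\
    exists x, argmin (S t) (f t) x /\ e <= `|x - x0|).
  apply: near_sub => t nt Tt x mx; rewrite ltNge; apply/negP => ex.
  by apply: nt; split=> //; exists x.
apply: near_ultra => U uU Ut0 UBad.
pose s t : 'rV[R]_d := xget 0 [set x | argmin (S t) (f t) x /\ e <= `|x - x0|].
have Us : U [set t | argmin (S t) (f t) (s t) /\ e <= `|s t - x0|].
  by apply: filterS UBad => t [_ ex]; exact: (xgetPex 0 ex).
have US : U [set t | Theta t /\ S t (s t)].
  by apply: filterS (filterI UBad Us) => t [[Tt _] [[St _] _]].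
have [p Sp Up] := ultra_sol uU Ut0 US.
have cont q := has_diff_continuous (has_diff_uncurry q.1 q.2 Cf).
have : argmin (S t0) (f t0) p.
  split=> // y Sy; rewrite (le_trans _ (fx0 y Sy))// leNgt; apply/negP => lt.
  pose e1 := (f t0 p - f t0 x0) / 3.
  have e10 : 0 < e1 by rewrite divr_gt0// subr_gt0.
  have /continuous_dist/(_ _ e10)[r1 r10 h1] := cont (t0, p).
  have /continuous_dist/(_ _ e10)[r2 r20 h2] := cont (t0, x0).
  have r0 : 0 < Num.min r1 r2 by rewrite lt_min r10.
  have Ur : U [set t | `|t - t0| < Num.min r1 r2].
    exact: Ut0 (nbhs_dist _ r0).
  have Ul := Ut0 _ (lower_sol_lsc Tt0 cS Sx0 r20).
  have [t [[[[/= tr sr] [Tt _]] [[_ min_s] _]] /(_ Tt)[z Sz zr]]] :=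
    filter_ex (filterI (filterI (filterI (filterI Ur (Up _ r10)) US) Us) Ul).
  move: tr; rewrite lt_min => /andP[tr1 tr2].
  have := min_s z Sz.
  have := h1 (t, s t); rewrite norm_pair_lt/= tr1 sr => /(_ isT); rewrite ler_norml => /andP[+ _].
  have := h2 (t, z); rewrite norm_pair_lt/= tr2 zr => /(_ isT); rewrite ler_norml => /andP[_].
  exact: (third_gap lt).
rewrite min0 => px0; have [t [[_ es] sp]] := filter_ex (filterI Us (Up _ e0)).
by move: sp; rewrite /= px0 ltNge es.
Qed.

End Semicontinuity.

Lemma near_sub2 (R : realType) (V : normedModType R) (x : V) (A B C : V -> Prop) :
  (forall y, A y -> B y -> C y) -> (\forall y \near x, A y) ->
  (\forall y \near x, B y) -> \forall y \near x, C y.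
Proof.
by move=> ABC Ax Bx; apply: filterS (filterI Ax Bx) => y [/ABC]; exact.
Qed.

Lemma near_near (R : realType) (V : normedModType R) (x : V) (A : V -> Prop) :
  (\forall y \near x, A y) -> \forall y \near x, \forall z \near y, A z.
Proof. by move=> /near_join. Qed.

(** * Tangent spaces as kernels of the Hessian, and multipliers *)

Section Tangent.
Context {R : realType}.

(** The implicit function theorem for [z A(p) = b(p)]; its solution agrees with the formula wherever
    [A p] is invertible. *)
Lemma has_diff_solve (P : normedModType R) n (A : P -> 'M[R]_n)
    (b : P -> 'rV[R]_n) p0 :
  (forall p, exists L, has_diff true A p L) ->
  (forall p, exists L, has_diff true b p L) -> A p0 \in unitmx ->
  \forall p \near p0, A p \in unitmx /\
    exists L, has_diff true (fun p => b p *m invmx (A p)) p L.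
Proof.
move=> dA db uA.
pose Phi (q : P * 'rV[R]_n) := q.2 *m A q.1 - b q.1.
have dPhi q : exists2 L, has_diff true Phi q L & forall z, L (0, z) = z *m A q.1.
  have [LA hA] := dA q.1; have [Lb hb] := db q.1.
  have h1 := has_diff_bl true q (bl_fst P 'rV[R]_n).
  have h2 := has_diff_bl true q (bl_snd P 'rV[R]_n).
  have h3 := has_diffB (has_diff_mulmx h2 (has_diff_comp h1 hA)) (has_diff_comp h1 hb).
  eexists; first exact: h3.
  by move=> z /=; rewrite (bl0 hA.1) (bl0 hb.1) mulmx0 addr0 subr0.
pose z0 := b p0 *m invmx (A p0).
have [L0 hL0 L0E] := dPhi (p0, z0).
have L0inj z : L0 (0, z) = 0 -> z = 0.
  by rewrite L0E => /(congr1 (mulmx^~ (invmx (A p0)))); rewrite mulmxK// mul0mx.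
have Phi0 : Phi (p0, z0) = 0 by rewrite /Phi/= mulmxKV// subrr.
have [] := implicit_function _ hL0 L0inj Phi0.
  by apply: near_all => q; have [L hL _] := dPhi q; exists L.
move=> phi [_ phiP _].
have [LA /has_diff_continuous cA] := dA p0.
have uAn : \forall p \near p0, A p \in unitmx.
  by have := cA _ (unitmx_near uA); exact.
have E : \forall p \near p0, phi p = b p *m invmx (A p).
  apply: (near_sub2 _ uAn phiP) => p uAp [/eqP + _].
  by rewrite subr_eq0/= => /eqP <-; rewrite mulmxK.
have := near_sub2 (fun p uAp phip => conj uAp phip) uAn phiP.
apply: (near_sub2 _ (near_near E)) => p Ep [uAp [_ [M hM]]].
by split=> //; exists M; exact: has_diff_near Ep hM.
Qed.

Variables (m d : nat) (g : 'rV[R]_m -> 'rV[R]_d -> R).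
Let gg (p : 'rV[R]_m * 'rV[R]_d) := g p.1 p.2.
Let S t := lower_sol g t.
Hypothesis Cg : Ck 2 setT gg.
Let Cg1 : Ck 1 setT gg := CkW Cg.
Variables (Theta : set 'rV[R]_m) (t0 : 'rV[R]_m) (a : 'rV[R]_d).
Variables (X : 'rV[R]_m * 'rV[R]_d -> 'rV[R]_d) (r : R).
Hypothesis chart : solution_chart g Theta t0 a X r.
Let P := proj_range (hess (g t0) a).

Lemma chart_fixed t x : `|t - t0| < r -> `|x - a| < r -> S t x -> X (t, x) = x.
Proof.
have [_ [_ _ Xfix _]] := chart => tr xr Sx.
apply: Xfix; first by rewrite norm_pair_lt/= tr.
exact: lower_sol_crit.
Qed.

(** Differentiates in [y] the vanishing of the gradient at [X (t, y)], valid because these points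
    are minimizers, and the equation fixing the kernel component. *)
Lemma chart_velocity t x M v : `|t - t0| < r -> `|x - a| < r -> Theta t ->
  S t x -> has_diff true X (t, x) M ->
  M (0, v) *m hess (g t) x = 0 /\ (M (0, v) - v) *m (1%:M - P) = 0.
Proof.
move=> tr xr Tt Sx hM; have Xx := chart_fixed tr xr Sx.
have [r0 [X0 XP Xfix fill]] := chart.
have hy : has_diff true (fun y : 'rV[R]_d => (t, y)) x (fun v => (0, v)).
  by apply: has_diff_pair; [exact: has_diff_cst|exact: has_diff_bl (bl_id _)].
have hX := has_diff_comp hy hM.
have xn : \forall y \near x, `|y - a| < r.
  apply/near_dist; exists (r - `|x - a|); first by rewrite subr_gt0.
  move=> y yx; rewrite -(subrKA x) (le_lt_trans (ler_normD _ _))//.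
  by rewrite -ltrBrDr.
split.
  have hG := has_diff_grad_snd t (X (t, x)) Cg.
  have htX := has_diff_pair (has_diff_cst true t x) hX.
  have hGX := has_diff_comp htX hG.
  have h0 := has_diff_cst true (0 : 'rV[R]_d) x.
  have E : \forall y \near x, (fun p => grad (g p.1) p.2) (t, X (t, y)) = 0.
    apply: near_sub xn => y yr /=; apply: lower_sol_crit => //.
    exact: (fill _ x).
  have := has_diff_unique (has_diff_near E hGX) h0 v.
  by rewrite /= mul0mx add0r Xx.
have h1 := has_diffB hX (has_diff_bl true x (bl_id _)).
have h2 := has_diff_comp h1 (has_diff_bl true _ (bl_mulmxr _ (1%:M - P))).
have E : \forall y \near x, (X (t, y) - y) *m (1%:M - P) = 0.
  apply: near_sub xn => y yr; have := XP (t, y).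
  by rewrite norm_pair_lt/= tr yr => /(_ isT)[].
have h0 := has_diff_cst true (0 : 'rV[R]_d) x.
exact: (has_diff_unique (has_diff_near E h2) h0 v).
Qed.

(** The difference [M (0, k) - k] is killed by the Hessian and by [1 - P], hence by the invertible
    matrix. *)
Lemma chart_velocity_ker t x M k : `|t - t0| < r -> `|x - a| < r -> Theta t ->
  S t x -> hess (g t) x *m P + (1%:M - P) \in unitmx ->
  has_diff true X (t, x) M -> k *m hess (g t) x = 0 -> M (0, k) = k.
Proof.
move=> tr xr Tt Sx uA hM kH.
have [MH MQ] := chart_velocity k tr xr Tt Sx hM.
apply/eqP; rewrite -subr_eq0; apply/eqP; set w := M (0, k) - k in MQ *.
have wH : w *m hess (g t) x = 0 by rewrite mulmxBl MH kH subrr.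
have : w *m (hess (g t) x *m P + (1%:M - P)) = 0.
  by rewrite mulmxDr MQ addr0 mulmxA wH mul0mx.
by move=> /(congr1 (mulmx^~ (invmx (hess (g t) x *m P + (1%:M - P)))));
  rewrite mulmxK// mul0mx.
Qed.

(** The curve [s |-> X (t0, x + s k)] runs in [S t0] and has velocity [k] at 0. *)
Lemma ker_tangent x k : Theta t0 -> `|x - a| < r -> S t0 x ->
  hess (g t0) x *m P + (1%:M - P) \in unitmx ->
  k *m hess (g t0) x = 0 -> tangent_space (S t0) x k.
Proof.
move=> Tt xr Sx uA kH; have [r0 [X0 XP Xfix fill]] := chart.
have tr : `|t0 - t0| < r by rewrite subrr normr0.
pose l (s : R) := x + s *: k.
have lc : continuous l.
  move=> s; have := has_diff_line (s := true) (v := k) (t := s)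
    (has_diff_bl true (x + s *: k) (bl_id _)).
  exact: has_diff_continuous.
pose I := l @^-1` [set y | `|y - a| < r].
have oI : open I.
  apply: open_comp; first by move=> s _; exact: lc.
  rewrite openE => y /= yr; apply: (proj2 (near_dist (V := 'rV[R]_d) y _)).
  exists (r - `|y - a|).
    by rewrite subr_gt0.
  move=> z zy; rewrite /= -(subrKA y) (le_lt_trans (ler_normD _ _))//.
  by rewrite -ltrBrDr.
have I0 : I 0 by rewrite /I/l/= scale0r addr0.
have dX y : `|y - a| < r -> exists M, has_diff true X (t0, y) M.
  by move=> yr; have := XP (t0, y); rewrite norm_pair_lt/= tr yr => /(_ isT)[].
have hX y M : has_diff true X (t0, y) M ->
    has_diff true (fun y => X (t0, y)) y (fun v => M (0, v)).
  apply: has_diff_comp.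
  by apply: has_diff_pair; [exact: has_diff_cst|exact: has_diff_bl (bl_id _)].
exists (fun s => X (t0, l s)); split.
- exists I; first by split.
  apply: has_diff_Ck1 => // s Is; have [M hM] := dX _ Is.
  by eexists; exact: has_diff_line (hX _ _ hM).
- have := near_open oI I0; apply: near_sub => s Is.
  exact: (fill _ x).
- by rewrite /l scale0r addr0 (chart_fixed tr xr Sx).
- have [M hM] := dX _ I0.
  rewrite (has_diffE _ (has_diff_line (hX _ _ hM))) scale1r.
  have lx : l 0 = x by rewrite /l scale0r addr0.
  rewrite -/(l 0) lx in hM.
  by rewrite (chart_velocity_ker tr xr Tt Sx uA hM kH).
Qed.

Lemma tangent_ker t x v : tangent_space (S t) x v -> v *m hess (g t) x = 0.
Proof.
move=> [c [[I [oI I0] [dc _]] cS c0 <-]].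
have hc := differentiable_has_diff (dc 0 I0).
have hG := has_diffW false (has_diff_grad_snd t (c 0) Cg).
have htc := has_diff_pair (has_diff_cst false t (0 : R)) hc.
have hGc := has_diff_comp htc hG.
have E : \forall s \near (0 : R), (fun p => grad (g p.1) p.2) (t, c s) = 0.
  by apply: near_sub cS => s Sc; exact: lower_sol_crit.
have h0 := has_diff_cst false (0 : 'rV[R]_d) (0 : R).
have := has_diff_unique (has_diff_near E hGc) h0 1.
by rewrite /= mul0mx add0r c0 (has_diffE _ hc).
Qed.

(** [x] is a local minimum of [y |-> f t (X (t, y))], and the chart has velocity [k] in the
    direction [k]. *)
Lemma upper_grad_perp (f : 'rV[R]_m -> 'rV[R]_d -> R) t x k :
  Ck 1 setT (fun p : 'rV[R]_m * 'rV[R]_d => f p.1 p.2) ->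
  `|t - t0| < r -> `|x - a| < r -> Theta t -> argmin (S t) (f t) x ->
  hess (g t) x *m P + (1%:M - P) \in unitmx ->
  k *m hess (g t) x = 0 -> dot (grad (f t) x) k = 0.
Proof.
move=> Cf tr xr Tt [Sx minx] uA kH.
have Xx := chart_fixed tr xr Sx.
have [r0 [X0 XP Xfix fill]] := chart.
have := XP (t, x); rewrite norm_pair_lt/= tr xr => /(_ isT)[_ _ [M hM]].
rewrite dotC -(chart_velocity_ker tr xr Tt Sx uA hM kH).
have hy : has_diff true (fun y : 'rV[R]_d => (t, y)) x (fun v => (0, v)).
  by apply: has_diff_pair; [exact: has_diff_cst|exact: has_diff_bl (bl_id _)].
have hf := has_diff_snd true t (X (t, x)) Cf.
have H1 := has_diff_min (has_diff_comp (has_diff_comp hy hM) hf).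
rewrite -{1}Xx; apply: (H1 _ k).
apply/near_dist; exists (r - `|x - a|); first by rewrite subr_gt0.
move=> y yx; rewrite /= Xx; apply: minx; apply: (fill _ x) => //.
by rewrite -(subrKA x) (le_lt_trans (ler_normD _ _))// -ltrBrDr.
Qed.

(** A multiplier [v] is free up to the kernel of the Hessian at [(t, x)]. Subtracting the chart
    velocity [M (0, v)], a kernel vector with the same image under [1 - P], normalizes it against
    the fixed projection at the base point. *)
Lemma upper_multiplier (f : 'rV[R]_m -> 'rV[R]_d -> R) t x :
  Ck 1 setT (fun p : 'rV[R]_m * 'rV[R]_d => f p.1 p.2) ->
  `|t - t0| < r -> `|x - a| < r -> Theta t -> argmin (S t) (f t) x ->
  hess (g t) x *m P + (1%:M - P) \in unitmx ->
  exists u, grad (f t) x = u *m hess (g t) x *m hess (g t) x /\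
            u *m (1%:M - P) = 0.
Proof.
move=> Cf tr xr Tt minx uA.
have [v fE] := perp_ker_range (hess_sym t x Cg)
  (fun k => @upper_grad_perp f t x k Cf tr xr Tt minx uA).
have [r0 [X0 XP Xfix fill]] := chart.
have := XP (t, x); rewrite norm_pair_lt/= tr xr => /(_ isT)[_ _ [M hM]].
have [MH MQ] := chart_velocity v tr xr Tt minx.1 hM.
exists (v - M (0, v)); split; first by rewrite mulmxBl MH subr0.
by rewrite -opprB mulNmx MQ oppr0.
Qed.

End Tangent.

(** * The second fundamental form in terms of third derivatives of [g] *)

Section Curvature.
Context {R : realType}.
Variables (m d : nat) (g : 'rV[R]_m -> 'rV[R]_d -> R).
Let gg (p : 'rV[R]_m * 'rV[R]_d) := g p.1 p.2.
Let S t := lower_sol g t.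
Hypothesis Cg3 : Ck 3 setT gg.
Let Cg : Ck 2 setT gg := CkW Cg3.
Variables (Theta : set 'rV[R]_m) (t0 : 'rV[R]_m) (a : 'rV[R]_d).
Variables (X : 'rV[R]_m * 'rV[R]_d -> 'rV[R]_d) (r : R).
Hypothesis chart : solution_chart g Theta t0 a X r.
Hypotheses (Tt0 : Theta t0) (Sa : S t0 a).
Let H0 := hess (g t0) a.
Let P := proj_range H0.

(** Block diagonal: [H0] on its range and the identity on its kernel. *)
Lemma chart_matrix_unit : H0 *m P + (1%:M - P) \in unitmx.
Proof.
have symH : H0^T = H0 := hess_sym t0 a Cg.
apply: injective_unitmx => v; rewrite mulmxDr mulmxA => vE.
have [|vHP vQ] := proj_sum_eq0 (H := H0) _ vE.
  by rewrite -mulmxA proj_range_idem.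
by apply: ker_split vQ; move: vHP; rewrite -mulmxA (proj_range_mulr symH).
Qed.

Lemma has_diff_hess_snd t x : exists L, has_diff true (hess (g t)) x L.
Proof.
have [L hL] := has_diff_hess (t, x) Cg3.
have hy : has_diff true (fun y : 'rV[R]_d => (t, y)) x (fun v => (0, v)).
  by apply: has_diff_pair; [exact: has_diff_cst|exact: has_diff_bl (bl_id _)].
by eexists; exact: (has_diff_comp hy hL).
Qed.

(* The field [W y = v Q (H P + Q)^-1] is tangent to the solution set: it is the
   velocity of the curve [s |-> X (t0, y + s v)]. *)
Lemma second_fundamental_form_exists v : v *m H0 = 0 ->
  exists u, is_second_fundamental_form (S t0) a v v u.
Proof.
move=> vH; pose Q := 1%:M - P.
have symH : H0^T = H0 := hess_sym t0 a Cg.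
pose A y := hess (g t0) y *m P + Q.
have dA y : exists L, has_diff true A y L.
  have [L hL] := has_diff_hess_snd t0 y.
  have h1 := has_diff_comp hL (has_diff_bl true _ (bl_mulmxr d P)).
  by eexists; exact: (has_diffD h1 (has_diff_cst true Q y)).
have db (y : 'rV[R]_d) : exists L, has_diff true (fun _ : 'rV[R]_d => v *m Q) y L.
  by eexists; exact: has_diff_cst.
have /near_dist[r1 r10 Wr1] := has_diff_solve dA db chart_matrix_unit.
set W := fun y => v *m Q *m invmx (A y) in Wr1.
have [r0 [X0 XP Xfix fill]] := chart.
have tr : `|t0 - t0| < r by rewrite subrr normr0.
have [r2 r20 [r21 r2r]] : exists2 r2, 0 < r2 & r2 <= r1 /\ r2 <= r.
  by exists (Num.min r1 r); rewrite ?lt_min ?r10// !ge_min !lexx orbT.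
have aa : `|a - a| < r1 by rewrite subrr normr0.
have aar : `|a - a| < r by rewrite subrr normr0.
have [_ [LW hW]] := Wr1 _ aa.
have Wa : W a = v.
  have vA : v *m Q = v *m A a by rewrite /A mulmxDr mulmxA -/H0 vH mul0mx add0r.
  by rewrite /W vA mulmxK// chart_matrix_unit.
(* [P] projects onto the normal space, so this is the normal component of the derivative of [W]. *)
exists ('D_v W a *m P), [set y | `|y - a| < r2], W; split=> //.
- split; last by rewrite /= subrr normr0.
  rewrite openE => y /= yr; apply: (proj2 (near_dist (V := 'rV[R]_d) y _)).
  exists (r2 - `|y - a|); first by rewrite subr_gt0.
  move=> z zy; rewrite /= -(subrKA y) (le_lt_trans (ler_normD _ _))//.
  by rewrite -ltrBrDr.
- apply: has_diff_Ck1 => [|y yr].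
    rewrite openE => y /= yr; apply: (proj2 (near_dist (V := 'rV[R]_d) y _)).
    exists (r2 - `|y - a|); first by rewrite subr_gt0.
    move=> z zy; rewrite /= -(subrKA y) (le_lt_trans (ler_normD _ _))//.
    by rewrite -ltrBrDr.
  by have [_] := Wr1 _ (lt_le_trans yr r21).
- move=> y yr Sy; have yr' := lt_le_trans yr r2r.
  have [uA _] := Wr1 _ (lt_le_trans yr r21).
  apply: (ker_tangent Cg chart Tt0 yr' Sy uA).
  have := XP (t0, y); rewrite norm_pair_lt/= tr yr' => /(_ isT)[_ _ [M hM]].
  have [MH MQ] := chart_velocity Cg chart v tr yr' Tt0 Sy hM.
  suff -> : W y = M (0, v) by [].
  rewrite /W; have -> : v *m Q = M (0, v) *m A y.
    rewrite /A mulmxDr mulmxA MH mul0mx add0r.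
    by move/eqP: MQ; rewrite mulmxBl subr_eq0 => /eqP.
  by rewrite mulmxK.
split.
  move=> w /(tangent_ker Cg) wH; rewrite dot_mulmx (proj_range_sym H0).
  by rewrite (proj_range_ker wH) dotC dot0l.
apply: (ker_tangent Cg chart Tt0 aar Sa chart_matrix_unit).
by rewrite mulmxBl -mulmxA (proj_range_mull H0) subrr.
Qed.

(** Along a curve in [S t0] with velocity [v], a tangent field satisfies [W H = 0]; differentiating
    gives [(D_v W) H0 = - v LH (0, v)]. The tangential part of [D_v W] is killed by [H0]. *)
Lemma second_fundamental_form_hess v LH : v *m H0 = 0 ->
  has_diff true (fun p => hess (g p.1) p.2) (t0, a) LH ->
  second_fundamental_form (S t0) a v v *m H0 = - (v *m LH (0, v)).
Proof.
move=> vH hLH.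
have ar : `|a - a| < r by case: chart => r0 _; rewrite subrr normr0.
have [B [W [[oB Ba] [dW _] WT Wa [_ tan]]]] :
    is_second_fundamental_form (S t0) a v v (second_fundamental_form (S t0) a v v).
  by apply: xgetPex; exact: second_fundamental_form_exists.
have -> : second_fundamental_form (S t0) a v v *m H0 = 'D_v W a *m H0.
  apply/esym/eqP; rewrite -subr_eq0 -mulmxBl; apply/eqP.
  exact: (tangent_ker Cg tan).
have hW := differentiable_has_diff (dW a Ba).
have [c [[I [oI I0] [dc _]] cS c0 Dc]] : tangent_space (S t0) a v.
  exact: (ker_tangent Cg chart Tt0 ar Sa chart_matrix_unit vH).
have hc := differentiable_has_diff (dc 0 I0).
have cB : \forall s \near (0 : R), B (c s).
  have cc : c @ (0 : R) --> c 0 := has_diff_continuous hc.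
  by rewrite c0 in cc; exact: (cc _ (near_open oB Ba)).
rewrite -c0 in hW; have hWc := has_diff_comp hc hW.
have htc := has_diff_pair (has_diff_cst false t0 (0 : R)) hc.
have hLH' := has_diffW false hLH; rewrite -{1}c0 in hLH'.
have hHc := has_diff_comp htc hLH'.
have hprod := has_diff_mulmx hWc hHc.
have E : \forall s \near (0 : R),
    (W \o c) s *m ((fun p => hess (g p.1) p.2) \o (fun s => (t0, c s))) s = 0.
  apply: near_sub2 cB cS => s Bs Ss /=.
  exact: (tangent_ker Cg (WT _ Bs Ss)).
have h0 := has_diff_cst false (0 : 'rV[R]_d) (0 : R).
have := has_diff_unique (has_diff_near E hprod) h0 1.
have d1 : 'd c 0 1 = v by rewrite -Dc deriveE//; exact: dc.
rewrite /= d1 c0 Wa -/H0 -deriveE; last exact: dW.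
by move=> /eqP; rewrite addr_eq0 => /eqP.
Qed.

(** The curvature term becomes [<u H0, II H0>], so the Riemannian Hessian is the Hessian of the
    Lagrangian [h - <u H0, G>] on the kernel, with the multiplier [u H0] held fixed. *)
Lemma lagrangian_hess_pos (h : 'rV[R]_d -> R) u v LH :
  nondegenerate_at h (S t0) a -> grad h a = u *m H0 *m H0 ->
  has_diff true (fun p => hess (g p.1) p.2) (t0, a) LH ->
  v *m H0 = 0 -> v != 0 ->
  0 < qform (hess h a) v - dot (u *m H0) (v *m LH (0, v)).
Proof.
move=> nd hE hLH vH v0; have symH : H0^T = H0 := hess_sym t0 a Cg.
have ar : `|a - a| < r by case: chart => r0 _; rewrite subrr normr0.
have := nd v (ker_tangent Cg chart Tt0 ar Sa chart_matrix_unit vH) v0.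
rewrite /riemannian_hess hE (dot_mulmx _ H0) symH.
by rewrite (second_fundamental_form_hess vH hLH) dotC dotNl dotC.
Qed.

End Curvature.

(** * Solving the first-order system of the upper level *)

Section Selection.
Context {R : realType}.

Lemma dot_basis n i (u : 'rV[R]_n) : dot (basis_vec i) u = u 0 i.
Proof.
rewrite dotE (bigD1 i)//= !mxE !eqxx mul1r big1 ?addr0// => j ji.
by rewrite !mxE (negbTE ji) mul0r.
Qed.

Lemma row_mx_eq0 m n p q (Mg : 'M[R]_(m, n)) (Mf : 'M[R]_(m, q))
    (P : 'M[R]_(n, p)) (x : 'rV[R]_n) (y : 'rV[R]_p) (z w : 'rV[R]_q) :
  row_mx ((0 *m Mg + x) *m P + y) (0 *m Mf + z - w) = 0 ->
  x *m P + y = 0 /\ z = w.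
Proof.
rewrite !mul0mx !add0r => E; have := etrans E (esym (row_mx0 _ 1 p q)).
by move=> /eq_row_mx[-> /eqP]; rewrite subr_eq0 => /eqP.
Qed.

(** Pairs the linearized stationarity equation with a kernel vector: every term ending in [H] drops
    out by symmetry. *)
Lemma kkt_qform n (H A L : 'M[R]_n) (v b u : 'rV[R]_n) :
  H^T = H -> L^T = L -> v *m H = 0 ->
  v *m A = (b *m H + u *m L) *m H + u *m H *m L ->
  qform A v = dot (u *m H) (v *m L).
Proof.
move=> symH symL vH E; rewrite -[LHS]/(dot (v *m A) v) E dotDl.
by rewrite (dot_mulmx _ H) symH vH (dotC _ 0) dot0l add0r dot_mulmx symL.
Qed.

Lemma bl_dotl n (w : 'rV[R]_n) : bounded_linear (fun v => dot v w).
Proof.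
split=> [c u v|]; first by rewrite dotDl dotZl.
exists (n%:R * `|w|); first by rewrite mulr_ge0.
by move=> v; rewrite (le_trans (dot_norm_le _ _))// -mulrA (mulrC `|w|).
Qed.

Lemma has_diff_dot s (V : normedModType R) n (h k : V -> 'rV[R]_n) x L M :
  has_diff s h x L -> has_diff s k x M ->
  has_diff s (fun y => dot (h y) (k y)) x (fun v => dot (L v) (k x) + dot (h x) (M v)).
Proof.
move=> hL kM; apply: (@has_diff_bilinear R s _ _ _ _ (@dot R n) n%:R) => //.
- by move=> w; exact: bl_dotl.
- move=> v; have -> : dot v = (fun w => dot w v) by apply/funext => w; rewrite dotC.
  exact: bl_dotl.
- by move=> v w; exact: dot_norm_le.
Qed.

Variables (m d : nat) (f g : 'rV[R]_m -> 'rV[R]_d -> R).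
Let gg (p : 'rV[R]_m * 'rV[R]_d) := g p.1 p.2.
Let ff (p : 'rV[R]_m * 'rV[R]_d) := f p.1 p.2.
Let S t := lower_sol g t.
Hypotheses (Cg3 : Ck 3 setT gg) (Cf : Ck 2 setT ff).
Let Cg : Ck 2 setT gg := CkW Cg3.
Let Cf1 : Ck 1 setT ff := CkW Cf.

Lemma upper_valueE t x : argmin (S t) (f t) x -> upper_value f g t = f t x.
Proof.
move=> minx; have [y [Sy miny] <-] : is_min (S t) (f t) (upper_value f g t).
  by apply: (@xgetPex _ 0 (is_min (S t) (f t))); exists (f t x), x.
by case: minx => Sx minx; apply/eqP; rewrite eq_le miny//= minx.
Qed.

Lemma hess_diff_sym q LH : has_diff true (fun p => hess (g p.1) p.2) q LH ->
  forall v, (LH v)^T = LH v.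
Proof.
move=> hLH v; have := has_diff_comp hLH (has_diff_bl true _ (bl_trmx d d)).
have -> : (fun A : 'M[R]_d => A^T) \o (fun p => hess (g p.1) p.2) =
    (fun p => hess (g p.1) p.2).
  by apply/funext => p /=; rewrite hess_sym.
by move=> h; exact: (has_diff_unique h hLH v).
Qed.

(* First-order conditions for minimizing [f t] over the minimizers of [g t], the
   multiplier being written [u H] with [u] orthogonal to the kernel of the
   Hessian [H] at the base point. *)
Definition kkt (P : 'M[R]_d) t x u : Prop :=
  [/\ grad (g t) x *m P = 0, u *m (1%:M - P) = 0 &
      grad (f t) x = u *m hess (g t) x *m hess (g t) x].

(** [Psi] stacks the conditions of [kkt] into R^(d+d). For a kernel vector [(al, be)] of its
    differential in [(x, u)], the first block puts [al] in ker [H0] and [be] orthogonal to it;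
    pairing the second with [al] contradicts [pos] unless [al = 0], and then [be H0 H0 = 0] forces
    [be = 0]. *)
Lemma kkt_selection t0 a u0 LH : let H0 := hess (g t0) a in
  let P := proj_range H0 in
  kkt P t0 a u0 ->
  has_diff true (fun p => hess (g p.1) p.2) (t0, a) LH ->
  (forall v, v *m H0 = 0 -> v != 0 ->
    0 < qform (hess (f t0) a) v - dot (u0 *m H0) (v *m LH (0, v))) ->
  exists xs us, [/\ xs t0 = a,
    \forall t \near t0, (exists L, has_diff true xs t L) /\
                        (exists L, has_diff true us t L) &
    \forall q \near (t0, (a, u0)), kkt P q.1 q.2.1 q.2.2 ->
      q.2.1 = xs q.1 /\ q.2.2 = us q.1].
Proof.
move=> H0 P [Ga u0Q fE] hLH pos.
have symH : H0^T = H0 := hess_sym t0 a Cg.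
pose Psi (q : 'rV[R]_m * 'rV[R]_(d + d)) : 'rV[R]_(d + d) :=
  row_mx (grad (g q.1) (lsubmx q.2) *m P + rsubmx q.2 *m (1%:M - P))
    (grad (f q.1) (lsubmx q.2) -
     rsubmx q.2 *m hess (g q.1) (lsubmx q.2) *m hess (g q.1) (lsubmx q.2)).
have dPsi q L : has_diff true (fun p => hess (g p.1) p.2) (q.1, lsubmx q.2) L ->
  has_diff true Psi q (fun v => row_mx
   ((v.1 *m hess_mixed g q.1 (lsubmx q.2) +
     lsubmx v.2 *m hess (g q.1) (lsubmx q.2)) *m P + rsubmx v.2 *m (1%:M - P))
   (v.1 *m hess_mixed f q.1 (lsubmx q.2) +
    lsubmx v.2 *m hess (f q.1) (lsubmx q.2) -
    ((rsubmx v.2 *m hess (g q.1) (lsubmx q.2) +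
      rsubmx q.2 *m L (v.1, lsubmx v.2)) *m hess (g q.1) (lsubmx q.2) +
     rsubmx q.2 *m hess (g q.1) (lsubmx q.2) *m L (v.1, lsubmx v.2)))).
  move=> hL.
  have b1 := bl_fst 'rV[R]_m 'rV[R]_(d + d).
  have b2 := bl_snd 'rV[R]_m 'rV[R]_(d + d).
  have bl := bl_comp (bl_lsubmx d d) b2.
  have br := bl_comp (bl_rsubmx d d) b2.
  have hp := has_diff_bl true q (bl_pair b1 bl).
  have hr := has_diff_bl true q br.
  have hG := has_diff_comp hp (has_diff_grad_snd q.1 (lsubmx q.2) Cg).
  have hf := has_diff_comp hp (has_diff_grad_snd q.1 (lsubmx q.2) Cf).
  have hH := has_diff_comp hp hL.
  have h1 := has_diffD (has_diff_comp hG (has_diff_bl true _ (bl_mulmxr _ P)))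
    (has_diff_comp hr (has_diff_bl true _ (bl_mulmxr _ (1%:M - P)))).
  have h2 := has_diffB hf (has_diff_mulmx (has_diff_mulmx hr hH) hH).
  exact: (has_diff_comp (has_diff_pair h1 h2) (has_diff_bl true _ (bl_row_mx d d))).
pose z0 := row_mx a u0.
have lz0 : lsubmx z0 = a by rewrite row_mxKl.
have rz0 : rsubmx z0 = u0 by rewrite row_mxKr.
have hLH0 : has_diff true (fun p => hess (g p.1) p.2) (t0, lsubmx z0) LH.
  by rewrite lz0.
have hPsi0 := dPsi (t0, z0) LH hLH0.
have inj : forall z : 'rV[R]_(d + d), row_mx
   ((0 *m hess_mixed g t0 (lsubmx z0) + lsubmx z *m hess (g t0) (lsubmx z0)) *m P
     + rsubmx z *m (1%:M - P))
   (0 *m hess_mixed f t0 (lsubmx z0) + lsubmx z *m hess (f t0) (lsubmx z0) -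
    ((rsubmx z *m hess (g t0) (lsubmx z0) + rsubmx z0 *m LH (0, lsubmx z))
      *m hess (g t0) (lsubmx z0) +
     rsubmx z0 *m hess (g t0) (lsubmx z0) *m LH (0, lsubmx z))) = 0 -> z = 0.
  move=> z; rewrite lz0 rz0 -/H0.
  have : z = row_mx (lsubmx z) (rsubmx z) by rewrite hsubmxK.
  move: (lsubmx z) (rsubmx z) => al be -> /row_mx_eq0[E1 E2].
  have [|aHP bQ] := proj_sum_eq0 (H := H0) _ E1.
    by rewrite -mulmxA (proj_range_idem H0).
  have aH : al *m H0 = 0 by move: aHP; rewrite -mulmxA (proj_range_mulr symH).
  have al0 : al = 0.
    apply/eqP; apply: contraT => aln0; have := pos al aH aln0.
    by rewrite (kkt_qform symH (hess_diff_sym hLH _) aH E2) subrr ltxx.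
  move: E2; rewrite al0 mul0mx (bl0 hLH.1) !mulmx0 !addr0 => /esym bHH.
  by rewrite (ker_split (mulmx_sqr_eq0 symH bHH) bQ) row_mx0.
have Psi0 : Psi (t0, z0) = 0.
  by rewrite /Psi/= lz0 rz0 Ga u0Q fE addr0 subrr row_mx0.
have [] := implicit_function _ hPsi0 inj Psi0.
  apply: near_all => q; have [L hL] := has_diff_hess (q.1, lsubmx q.2) Cg3.
  by eexists; exact: dPsi hL.
move=> phi [phi0 phin phiu].
exists (lsubmx \o phi), (rsubmx \o phi); split; first by rewrite /= phi0.
  apply: near_sub phin => t [_ [M hM]]; split; eexists.
    exact: has_diff_comp hM (has_diff_bl true _ (bl_lsubmx d d)).
  exact: has_diff_comp hM (has_diff_bl true _ (bl_rsubmx d d)).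
have [_ [C C0 hC]] := bl_row_mx (R := R) d d.
move: phiu => /near_dist[r r0 phiu]; apply/near_dist.
have C1 : 0 < C + 1 by rewrite ltr_wpDl.
exists (Num.min r (r / (C + 1))); first by rewrite lt_min r0 divr_gt0.
move=> [t [x u]]; rewrite lt_min => /andP[qr qrC] [k1 k2 k3].
have tr : `|t - t0| < r by move: qr; rewrite norm_pair_lt => /andP[].
have xur : `|(x, u) - (a, u0)| < r / (C + 1).
  by move: qrC; rewrite norm_pair_lt => /andP[].
have Ez : row_mx x u - z0 = row_mx (x - a) (u - u0).
  by rewrite /z0 opp_row_mx add_row_mx.
have : row_mx x u = phi t.
  apply: (phiu (t, row_mx x u)).
    rewrite norm_pair_lt/= tr/= Ez (le_lt_trans (hC ((x, u) - (a, u0))))//.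
    rewrite (@le_lt_trans _ _ ((C + 1) * `|(x, u) - (a, u0)|))//.
      by rewrite ler_wpM2r// lerDl.
    by rewrite mulrC -ltr_pdivlMr.
  by rewrite /Psi/= row_mxKl row_mxKr k1 k2 k3 addr0 subrr row_mx0.
by move=> E; rewrite /= -E row_mxKl row_mxKr.
Qed.

End Selection.

(** * The minimizers near the base parameter form a C^1 branch *)

Section Upper.
Context {R : realType}.

Lemma mulmx_sum_solve n (A Q : 'M[R]_n) (u b : 'rV[R]_n) :
  A + Q \in unitmx -> u *m A = b -> u *m Q = 0 -> u = b *m invmx (A + Q).
Proof.
move=> uA <- uQ; rewrite -[LHS](mulmxK uA); congr (_ *m _).
by rewrite mulmxDr uQ addr0.
Qed.

(** A minimizer [x] for [t] near [t0] is close to [x0] and solves [kkt] with some [u]. Since [u]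
    solves [u (H H P + Q) = grad f P], it depends continuously on [(t, x)], so [(t, x, u)] enters
    the neighborhood where [kkt_selection] is unique. *)
Lemma minimizer_selection (m d : nat) (Theta : set 'rV[R]_m)
    (f g : 'rV[R]_m -> 'rV[R]_d -> R) (mu : R) (V : set 'rV[R]_d) t0 x0 :
  Ck 2 setT (fun p : 'rV[R]_m * 'rV[R]_d => f p.1 p.2) ->
  Ck 3 setT (fun p : 'rV[R]_m * 'rV[R]_d => g p.1 p.2) ->
  0 < mu -> compact V ->
  (forall t, Theta t -> PLcirc mu V (g t)) ->
  (forall t, Theta t -> lower_sol g t !=set0) ->
  connected (lower_sol g t0) -> Theta t0 ->
  argmin (lower_sol g t0) (f t0) = [set x0] ->
  nondegenerate_at (f t0) (lower_sol g t0) x0 ->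
  exists xs us, [/\ xs t0 = x0,
    \forall t \near t0, (exists L, has_diff true xs t L) /\
                        (exists L, has_diff true us t L) &
    \forall t \near t0, Theta t ->
      forall x, argmin (lower_sol g t) (f t) x -> x = xs t /\
        grad (f t) x = us t *m hess (g t) x *m hess (g t) x].
Proof.
move=> Cf Cg3 mu0 cV PL S0 cS Tt0 min0 nd; have Cg := CkW Cg3.
have Cf1 := CkW Cf.
have minx0 : argmin (lower_sol g t0) (f t0) x0 by rewrite min0.
have [Sx0 _] := minx0.
have [X [r chart]] := lower_sol_chart mu0 Cg PL Tt0 Sx0.
have [r0 _] := chart.
have tt : `|t0 - t0| < r by rewrite subrr normr0.
have xx : `|x0 - x0| < r by rewrite subrr normr0.
pose P := proj_range (hess (g t0) x0); pose Q := 1%:M - P.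
have symH : (hess (g t0) x0)^T = hess (g t0) x0 := hess_sym t0 x0 Cg.
have uB := chart_matrix_unit Cg3 t0 x0.
have [u0 [fE u0Q]] := upper_multiplier Cg chart Cf1 tt xx Tt0 minx0 uB.
have k0 : kkt f g P t0 x0 u0.
  by split=> //; rewrite (lower_sol_crit (CkW Cg) Sx0) mul0mx.
have [LH hLH] := has_diff_hess (t0, x0) Cg3.
have pos v := lagrangian_hess_pos Cg3 chart Tt0 Sx0 (v := v) nd fE hLH.
have [xs [us [xs0 sel uniq]]] := kkt_selection Cg3 Cf k0 hLH pos.
exists xs, us; split=> //.
move: uniq => /near_dist[r1 r10 uniq].
pose Hp (p : 'rV[R]_m * 'rV[R]_d) := hess (g p.1) p.2.
have dH p : exists L, has_diff true Hp p L := has_diff_hess p Cg3.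
have dP (B : 'rV[R]_m * 'rV[R]_d -> 'M[R]_d) p :
    (exists L, has_diff true B p L) ->
    exists L, has_diff true (fun p => B p *m P + Q) p L.
  move=> [L hL]; have h1 := has_diff_comp hL (has_diff_bl true _ (bl_mulmxr d P)).
  by eexists; exact: (has_diffD h1 (has_diff_cst true Q p)).
have dA p : exists L, has_diff true (fun p => Hp p *m Hp p *m P + Q) p L.
  by apply: dP; have [L hL] := dH p; eexists; exact: (has_diff_mulmx hL hL).
have db p : exists L, has_diff true (fun p => grad (f p.1) p.2 *m P) p L.
  case: p => t x; eexists.
  exact: has_diff_comp (has_diff_grad_snd t x Cf) (has_diff_bl true _ (bl_mulmxr 1 P)).
have uA : Hp (t0, x0) *m Hp (t0, x0) *m P + Q \in unitmx.
  apply: injective_unitmx => v; rewrite mulmxDr mulmxA => vE.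
  have [|vP vQ] := proj_sum_eq0 (H := hess (g t0) x0) _ vE.
    by rewrite -mulmxA proj_range_idem.
  apply: ker_split vQ; apply: (mulmx_sqr_eq0 symH).
  by move: vP; rewrite /Hp/= -mulmxA -(mulmxA _ _ P) (proj_range_mulr symH) mulmxA.
have ueq t x u : Hp (t, x) *m Hp (t, x) *m P + Q \in unitmx ->
    grad (f t) x = u *m Hp (t, x) *m Hp (t, x) -> u *m Q = 0 ->
    u = grad (f t) x *m P *m invmx (Hp (t, x) *m Hp (t, x) *m P + Q).
  by move=> uAt -> uQ; apply: mulmx_sum_solve uAt _ uQ; rewrite !mulmxA.
have /near_dist[r2 r20 sol] := has_diff_solve dA db uA.
have [_ [L /has_diff_continuous/continuous_dist/(_ (r1 / 2))]] :=
  sol (t0, x0) ltac:(by rewrite subrr normr0).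
case=> [|r3 r30 cu]; first by rewrite divr_gt0.
have [LB hLB] := dP Hp (t0, x0) (dH _).
have /near_dist[r4 r40 uBn] :
    \forall p \near (t0, x0), Hp p *m P + Q \in unitmx.
  by have := has_diff_continuous hLB (unitmx_near uB); exact.
have [e [e0 [er er1 er2 er3 er4]]] : exists e, 0 < e /\
    [/\ e <= r, e <= r1, e <= r2, e <= r3 & e <= r4].
  exists (Num.min r (Num.min (Num.min r1 r2) (Num.min r3 r4))).
  split; first by rewrite !lt_min r0 r10 r20 r30.
  by split; rewrite !ge_min lexx ?orbT.
have minn := upper_min_near mu0 Cg cV PL S0 Cf1 Tt0 cS min0 e0.
apply: near_sub2 minn (nbhs_dist t0 e0) => t mint te Tt x minx.
have xe := mint Tt x minx.
have pe : `|(t, x) - (t0, x0)| < e by rewrite norm_pair_lt/= te xe.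
have uBt := uBn (t, x) (lt_le_trans pe er4).
have [u [fu uQ]] := upper_multiplier Cg chart Cf1 (lt_le_trans te er)
  (lt_le_trans xe er) Tt minx uBt.
have [uAt _] := sol _ (lt_le_trans pe er2).
have ut := ueq t x u uAt fu uQ.
have u0t := ueq t0 x0 u0 uA fE u0Q.
have kt : kkt f g P t x u.
  by split=> //; rewrite (lower_sol_crit (CkW Cg) minx.1) mul0mx.
have ur : `|u - u0| < r1.
  rewrite ut u0t (le_lt_trans (cu (t, x) (lt_le_trans pe er3)))//.
  by rewrite gtr_pMr// invf_lt1// ltr1n.
have [] := uniq (t, (x, u)) _ kt.
  by rewrite !norm_pair_lt/= ur (lt_le_trans te er1) (lt_le_trans xe er1).
by move=> /= <- <-.
Qed.

Lemma ball_open (W : normedModType R) (x : W) r : open [set y | `|y - x| < r].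
Proof.
rewrite openE => y /= yr; apply: (proj2 (near_dist y _)).
exists (r - `|y - x|); first by rewrite subr_gt0.
move=> z zy; rewrite /= -(subrKA y) (le_lt_trans (ler_normD _ _))//.
by rewrite -ltrBrDr.
Qed.

End Upper.

(** * Assembly: the selection, its uniqueness and the gradient of the upper value *)

Theorem theorem3p6 (R : realType) (m d : nat) (Theta : set 'rV[R]_m)
    (f g : 'rV[R]_m -> 'rV[R]_d -> R) (mu : R) (V : set 'rV[R]_d)
    (theta0 : 'rV[R]_m) (x0 : 'rV[R]_d)
    (Theta_compact : compact Theta)
    (Theta_convex : convex_set (Theta : set (convex_lmodType 'rV[R]_m)))
    (f_C2 : Ck 2 setT (fun p : 'rV[R]_m * 'rV[R]_d => f p.1 p.2))
    (g_C3 : Ck 3 setT (fun p : 'rV[R]_m * 'rV[R]_d => g p.1 p.2))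
    (mu_gt0 : 0 < mu) (V_compact : compact V)
    (g_PLcirc : forall theta, Theta theta -> PLcirc mu V (g theta))
    (S_neq0 : forall theta, Theta theta -> lower_sol g theta !=set0)
    (S_connected : forall theta, Theta theta -> connected (lower_sol g theta))
    (Theta_theta0 : Theta theta0)
    (x0_unique_min : argmin (lower_sol g theta0) (f theta0) = [set x0])
    (x0_nondegenerate :
      nondegenerate_at (f theta0) (lower_sol g theta0) x0) :
  exists (O : set 'rV[R]_m) (xs : 'rV[R]_m -> 'rV[R]_d),
    let U := Theta `&` O in
    [/\ open O /\ O theta0,
        C1_selection f g theta0 x0 U xs,
        forall ys, C1_selection f g theta0 x0 U ys ->
          forall theta, U theta -> ys theta = xs theta
      & exists F' : 'rV[R]_m -> R,
          [/\ C1_extension U (upper_value f g) F',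
              forall theta, U theta ->
                grad F' theta = hypergradient f g theta (xs theta)
            & locally_lipschitz_on U (grad F')]].
Proof.
have Cg := CkW g_C3; have Cg1 := CkW Cg; have Cf1 := CkW f_C2.
have [xs [us [xs0 /near_dist[r1 r10 dsel] /near_dist[r2 r20 sel]]]] :=
  minimizer_selection f_C2 g_C3 mu_gt0 V_compact g_PLcirc S_neq0
    (S_connected _ Theta_theta0) Theta_theta0 x0_unique_min x0_nondegenerate.
pose r := Num.min r1 r2; have r0 : 0 < r by rewrite lt_min r10.
pose O := [set t : 'rV[R]_m | `|t - theta0| < r].
have oO : open O by exact: ball_open.
have dxs t : O t -> exists L, has_diff true xs t L.
  by rewrite /O/= lt_min => /andP[/dsel[]].
have dus t : O t -> exists L, has_diff true us t L.
  by rewrite /O/= lt_min => /andP[/dsel[]].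
have minU t : (Theta `&` O) t -> argmin (lower_sol g t) (f t) (xs t) /\
    grad (f t) (xs t) = us t *m hess (g t) (xs t) *m hess (g t) (xs t).
  move=> [Tt]; rewrite /O/= lt_min => /andP[_ tr].
  have [x minx] := upper_min_exists Cg V_compact g_PLcirc S_neq0 Cf1 Tt.
  by have [<- ->] := sel t tr Tt x minx.
have uniqU t : (Theta `&` O) t -> forall x,
    argmin (lower_sol g t) (f t) x -> x = xs t.
  move=> [Tt]; rewrite /O/= lt_min => /andP[_ tr] x minx.
  by have [] := sel t tr Tt x minx.
have xsC1 : Ck 1 O xs by apply: has_diff_Ck1.
exists O, xs => U; split.
- by split=> //; rewrite /O/= subrr normr0.
- split=> //; first by exists xs; split=> //; exists O => //; split=> // t [].
  move=> t Ut; have [mint _] := minU t Ut.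
  by split; [case: mint|exact: upper_valueE].
(* Any selection attains the upper value, hence is a minimizer. *)
- move=> ys [_ _ hys] t Ut; apply: (uniqU t Ut).
  have [mint _] := minU t Ut; have [Sy Fy] := hys t Ut.
  by split=> // z Sz; rewrite -Fy (upper_valueE mint); case: mint => _; exact.
pose w t := us t *m hess (g t) (xs t).
pose F' t := f t (xs t) - dot (w t) (grad (g t) (xs t)).
have dpair t Mx : has_diff true xs t Mx ->
    has_diff true (fun t => (t, xs t)) t (fun v => (v, Mx v)).
  by move=> hx; apply: has_diff_pair => //; exact: has_diff_bl (bl_id _).
have dw t : O t -> exists L, has_diff true w t L.
  move=> Ot; have [Mx hx] := dxs t Ot; have [Mu hu] := dus t Ot.
  have [LH hLH] := has_diff_hess (t, xs t) g_C3.
  by eexists; exact: has_diff_mulmx hu (has_diff_comp (dpair t Mx hx) hLH).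
have dF t Mx Mw : has_diff true xs t Mx -> has_diff true w t Mw ->
    has_diff true F' t (fun v =>
      dot v (grad (f^~ (xs t)) t) + dot (Mx v) (grad (f t) (xs t)) -
      (dot (Mw v) (grad (g t) (xs t)) + dot (w t)
        (v *m hess_mixed g t (xs t) + Mx v *m hess (g t) (xs t)))).
  move=> hx hw; have hp := dpair t Mx hx.
  have hf := has_diff_comp hp (has_diff_uncurry t (xs t) Cf1).
  have hG := has_diff_comp hp (has_diff_grad_snd t (xs t) Cg).
  exact: has_diffB hf (has_diff_dot hw hG).
(* The hypergradient freed of its pseudoinverse: a combination of strictly differentiable maps. *)
pose Gam t := grad (f^~ (xs t)) t - w t *m (hess_mixed g t (xs t))^T.
have hyperE t : U t -> hypergradient f g t (xs t) = Gam t.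
  move=> Ut; have [_ fE] := minU t Ut.
  rewrite /hypergradient /Gam fE -mulmxA pinv_mul_range; last exact: hess_sym.
  by rewrite trmx_mul trmxK.
have gradF t : U t -> grad F' t = Gam t.
  move=> Ut; have [mint fE] := minU t Ut; have [_ Ot] := Ut.
  have [Mx hx] := dxs t Ot; have [Mw hw] := dw t Ot.
  apply/rowP => i; rewrite mxE (has_diffE _ (dF t Mx Mw hx hw)).
  (* The derivative of [w] meets a zero gradient, and [w H = grad f] cancels both terms in the
     derivative of [xs]. *)
  rewrite (lower_sol_crit Cg1 mint.1) (dotC (Mw _)) dot0l add0r.
  rewrite (dotC (w t)) dotDl (dot_mulmx (Mx _)) (hess_sym _ _ Cg).
  have -> : w t *m hess (g t) (xs t) = grad (f t) (xs t) by rewrite fE.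
  rewrite (dot_mulmx _ (hess_mixed g t (xs t))) !dot_basis.
  rewrite [RHS]mxE [X in _ = _ + X]mxE.
  by rewrite [X in _ - X]addrC opprD addrA addrK.
exists F'; split.
- split=> [|t Ut].
    exists O; first by split=> // t [].
    apply: has_diff_Ck1 => // t Ot.
    have [Mx hx] := dxs t Ot; have [Mw hw] := dw t Ot.
    by eexists; exact: dF hx hw.
  have [mint _] := minU t Ut.
  rewrite (upper_valueE mint) /F' (lower_sol_crit Cg1 mint.1).
  by rewrite dotC dot0l subr0.
- by move=> t Ut; rewrite gradF// hyperE.
- move=> t Ut; have [_ Ot] := Ut; have [Mx hx] := dxs t Ot; have [Mw hw] := dw t Ot.
  have [Lf hLf] := has_diff_grad_fst (t, xs t) f_C2.
  have [Lm hLm] := has_diff_hess_mixed (t, xs t) g_C3.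
  have hf := has_diff_comp (dpair t Mx hx) hLf.
  have hm := has_diff_comp (has_diff_comp (dpair t Mx hx) hLm)
    (has_diff_bl true _ (bl_trmx m d)).
  (* Strict differentiability of [Gam] gives the Lipschitz bound, transferred to [grad F'] at points
     of [U], where the two agree. *)
  have [C C0 [r3 r30 lip]] := has_diff_lipschitz (has_diffB hf (has_diff_mulmx hw hm)).
  exists [set s | `|s - t| < r3]; first exact: nbhs_dist.
  exists C; split; first exact: num_real.
  move=> C' /ltW CC' [a b] [[/= Ua ar] [/= Ub br]].
  rewrite /= !gradF// (le_trans (lip a b ar br isT))//.
  by rewrite ler_wpM2r.
Qed.
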